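(* Let $\mathscr B$ be a uniformly convex family of Banach spaces and let $X$ be a separated disjoint union of finite spaces with bounded geometry such that $X$ is monogenic. Then $X$ has uniform geometric property $(T_{\mathscr B})$ if and only if the algebra $C_{\mathscr B,\max}(X)$ has a Kazhdan projection.
   Context: An extended metric space $(X,d)$ has bounded geometry if $\sup_{x}\#B(x,R)<\infty$ for all $R>0$. An entourage is a subset of $\{(x,y):d(x,y)\le R\}$ for some $R$; $X$ is monogenic if some entourage is generating, i.e. every entourage is contained in one of its $n$-fold compositions; $E_0$ denotes a fixed symmetric generating entourage. A separated disjoint union of $(X_n)$ carries the given metric on each $X_n$ and $d(X_n,X_m)=\infty$ for $n\neq m$ (countably many pieces). $\mathbb C_u[X]$ is the algebra of complex matrices $T=(T_{xy})_{x,y\in X}$ with uniformly bounded entries whose support $\mathrm{supp}(T)=\{(x,y):T_{xy}\ne 0\}$ is an entourage; $\ell^\infty(X)$ is the diagonal subalgebra; $T^*$ is the conjugate transpose. A partial translation is $V\in\mathbb C_u[X]$ with entries in $\{0,1\}$ and at most one nonzero entry in each row and each column; $R_V=\{x:\exists y,\ V_{xy}=1\}$; $V$ is full if it is the matrix of a bijection $X\to X$. $\|T\|_{\ell^1}=\inf\{\sum_{i=1}^N\|f_i\|_\infty : T=\sum_{i=1}^N f_iV_i,\ f_i\in\ell^\infty(X),\ V_i\text{ partial translations}\}$. A representation of $\mathbb C_u[X]$ on a Banach space $B$ is a unital homomorphism $\pi:\mathbb C_u[X]\to\mathcal L(B)$ with $\|\pi(T)\|\le\|T\|_{\ell^1}$.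 $B^\pi=\{\xi:\pi(V)\xi=\pi(\chi_{R_V})\xi\ \forall\text{ partial translations }V\}$. The dual representation on $B^*$ is $(\pi^*(T)f)(\xi)=f(\pi(T^* )\xi)$, with invariant space $(B^* )^{\pi^*}$ defined in the same way, and $B_\pi\subseteq B$ is the annihilator of $(B^* )^{\pi^*}$. For $B$ uniformly convex, $B=B^\pi\oplus B_\pi$; $p_\pi$ is the idempotent onto $B^\pi$ along $B_\pi$. $\pi$ has spectral gap greater than $c$ if, for some $c'>c$, for every $\xi$ with $\|[\xi]\|_{B/B^\pi}=1$ there is a partial translation $V$ with $\mathrm{supp}(V)\subseteq E_0$ and $\|[\pi(V)\xi-\pi(\chi_{R_V})\xi]\|_{B/B^\pi}\ge c'$. $X$ has uniform geometric property $(T_{\mathscr B})$ if there is $c>0$ such that all representations on all $B\in\mathscr B$ have spectral gap greater than $c$. $C_{\mathscr B,\max}(X)$ is the completion of $\mathbb C_u[X]$ in $\|a\|_{\mathscr B,\max}=\sup\{\|\pi(a)\|:\pi\text{ a representation on some }B\in\mathscr B\}$; each such $\pi$ extends to it. Fix full partial translations $A_1,\dots,A_n$ with support in $E_0$ such that every partial translation $V$ with $\mathrm{supp}(V)\subseteq E_0$ can be written $V=\sum_i\chi_{B_i}A_i$ with disjoint subsets $B_i\subseteq X$ (these exist by a known result), and put $A=\frac1n\sum_{i=1}^n\frac{1+A_i}2$. An element $p\in C_{\mathscr B,\max}(X)$ is a Kazhdan projection if (i) $\pi(p)=p_\pi$ for every representation $\pi$ on every $B\in\mathscr B$, and (ii)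 $A^k\to p$ in $C_{\mathscr B,\max}(X)$ with a summable rate, i.e. $\sum_{k\ge1}\|A^k-p\|_{\mathscr B,\max}<\infty$. With $\delta_B(t)=\inf\{1-\|\xi+\eta\|/2:\|\xi\|=\|\eta\|=1,\|\xi-\eta\|\ge t\}$, $\mathscr B$ is uniformly convex if $\inf_{B\in\mathscr B}\delta_B(t)>0$ for all $t\in(0,2]$. *)

(* Defs.v *)
From HB Require Import structures.
From mathcomp Require Import all_boot all_order all_algebra.
From mathcomp Require Import complex.
From mathcomp Require Import all_classical all_reals all_analysis.
Set Implicit Arguments.
Unset Strict Implicit.
Unset Printing Implicit Defensive.
Import Order.TTheory GRing.Theory Num.Theory.
Import numFieldNormedType.Exports.

Local Open Scope classical_set_scope.
Local Open Scope complex_scope.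
Local Open Scope ring_scope.

(* In a normed space over R[i] the library norm has values in R[i] (it is a
   nonnegative real there); rnorm is the same norm with values in R. *)
Definition rnorm (R : realType) (V : normedZmodType R[i]) (v : V) : R :=
  complex.Re `|v|.

Lemma rnormE (R : realType) (V : normedZmodType R[i]) (v : V) :
  (rnorm v)%:C = `|v|.
Proof. by rewrite /rnorm RRe_real // normr_real. Qed.

Lemma rnorm_ge0 (R : realType) (V : normedZmodType R[i]) (v : V) : 0 <= rnorm v.
Proof. by rewrite -lecR rnormE normr_ge0. Qed.

Lemma rnormD (R : realType) (V : normedZmodType R[i]) (u v : V) :
  rnorm (u + v) <= rnorm u + rnorm v.
Proof. by rewrite -lecR rmorphD /= !rnormE; exact: ler_normD. Qed.

Lemma rnormN (R : realType) (V : normedZmodType R[i]) (v : V) :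
  rnorm (- v) = rnorm v.
Proof. by rewrite /rnorm normrN. Qed.

Lemma rnorm0 (R : realType) (V : normedZmodType R[i]) : rnorm (0 : V) = 0.
Proof. by rewrite /rnorm normr0. Qed.

Section CoarseGeometry.
Context {R : realType}.

Definition is_metric (T : Type) (d : T -> T -> R) : Prop :=
  [/\ forall x y, 0 <= d x y,
      forall x y, d x y = 0 <-> x = y,
      forall x y, d x y = d y x &
      forall x y z, d x z <= d x y + d y z].

(* Separated disjoint union of the (Xn n, dn n), n : nat.  Some of the Xn n may
   be empty, so finitely many pieces are allowed. *)
Definition sepdist (Xn : nat -> finType) (dn : forall n, Xn n -> Xn n -> R)
    (u v : {n : nat & Xn n}) : \bar R :=
  if tag u == tag v then (dn (tag u) (tagged u) (tagged_as u v))%:E else +oo%E.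

Context {X : choiceType} (d : X -> X -> \bar R).

Definition bounded_geometry : Prop :=
  forall r : R, 0 < r -> exists N : nat,
    forall x, ([set y | (d x y <= r%:E)%E] #<= `I_N)%card.

(* Entourages of the bounded coarse structure; the name [entourage] belongs to
   the uniform spaces of the library. *)
Definition is_entourage (E : set (X * X)) : Prop :=
  exists r : R, E `<=` [set xy | (d xy.1 xy.2 <= r%:E)%E].

Fixpoint ncomp (E : set (X * X)) (n : nat) : set (X * X) :=
  if n is m.+1 then (E \; ncomp E m)%relation else range (fun x => (x, x)).

Definition generating (E : set (X * X)) : Prop :=
  is_entourage E /\
  forall F, is_entourage F -> exists2 n, (0 < n)%N & F `<=` ncomp E n.

Definition monogenic : Prop := exists E, generating E.

Definition symmetric_entourage (E : set (X * X)) : Prop := (E^-1)%relation = E.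

End CoarseGeometry.

Section RoeAlgebra.
Context {R : realType} {X : choiceType}.
Local Notation C := R[i].
Local Notation M := (X -> X -> C).
Implicit Types (T S V : M) (f : X -> C) (d : X -> X -> \bar R).

Definition supp T : set (X * X) := [set xy | T xy.1 xy.2 != 0].

Definition Cu d : set M :=
  [set T | (exists K : R, forall x y, rnorm (T x y) <= K) /\
           is_entourage d (supp T)].

Definition diag f : M := fun x y => if x == y then f x else 0.
Definition mone : M := diag (fun=> 1).
Definition mmul T S : M := fun x z => \sum_(y \in [set: X]) T x y * S y z.
Definition mpow T k : M := iter k (mmul T) mone.
Definition mstar T : M := fun x y => (T y x)^*.

Definition partial_translation d V : Prop :=
  [/\ Cu d V,
      forall x y, V x y = 0 \/ V x y = 1,
      forall x y z, V x y != 0 -> V x z != 0 -> y = z &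
      forall x y z, V x z != 0 -> V y z != 0 -> x = y].

(* diag of the indicator function of R_V *)
Definition chiR V : M := diag \1_[set x | exists y, V x y = 1].

Definition full_partial_translation d V : Prop :=
  partial_translation d V /\
  exists2 s : X -> X, bijective s & forall x y, V x y = (y == s x)%:R.

Definition bounded_function f : Prop := exists K : R, forall x, rnorm (f x) <= K.
Definition supnorm f : R := sup (range (fun x => rnorm (f x))).

Definition l1norm d T : R :=
  inf [set r | exists N (f : 'I_N -> X -> C) (V : 'I_N -> M),
    [/\ forall i, bounded_function (f i),
        forall i, partial_translation d (V i),
        T = \sum_(i < N) mmul (diag (f i)) (V i) &
        r = \sum_(i < N) supnorm (f i)]].

End RoeAlgebra.

Section Representations.
Context {R : realType} {X : choiceType} (d : X -> X -> \bar R).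
Local Notation C := R[i].
Local Notation M := (X -> X -> C).
Context {B : completeNormedModType C}.
Implicit Types (pi : M -> B -> B) (xi : B).

Definition opnorm (f : B -> B) : R :=
  sup [set r | exists2 xi, rnorm xi <= 1 & r = rnorm (f xi)].

(* Only the values of pi on Cu d matter. *)
Record representation pi : Prop := Representation {
  rep_linear : forall T, Cu d T -> linear (pi T) ;
  rep_continuous : forall T, Cu d T -> continuous (pi T) ;
  repP : forall (c : C) T S, Cu d T -> Cu d S ->
    forall xi, pi (c *: T + S) xi = c *: pi T xi + pi S xi ;
  repM : forall T S, Cu d T -> Cu d S ->
    forall xi, pi (mmul T S) xi = pi T (pi S xi) ;
  rep1 : forall xi, pi mone xi = xi ;
  rep_bound : forall T, Cu d T -> opnorm (pi T) <= l1norm d T }.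

(* B^pi *)
Definition invariants pi : set B :=
  [set xi | forall V, partial_translation d V -> pi V xi = pi (chiR V) xi].

Definition dual_space : set (B -> C^o) :=
  [set f : B -> C^o | linear f /\ continuous f].

Definition dual_rep pi (T : M) (f : B -> C^o) : B -> C^o :=
  fun xi => f (pi (mstar T) xi).

(* (B^* )^(pi^* ) *)
Definition dual_invariants pi : set (B -> C^o) :=
  [set f | dual_space f /\ forall V, partial_translation d V ->
           dual_rep pi V f = dual_rep pi (chiR V) f].

(* B_pi *)
Definition coinvariants pi : set B :=
  [set xi | forall f, dual_invariants pi f -> f xi = 0].

(* p_pi: the component in B^pi with respect to B = B^pi (+) B_pi.  The chosen
   vector is the unique one when this decomposition holds; 0 is a dummy value
   for vectors without a decomposition. *)
Definition invproj pi xi : B :=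
  xget 0 [set eta | invariants pi eta /\ coinvariants pi (xi - eta)].

(* quotient (semi)norm of the class of xi in B / W *)
Definition quot_norm (W : set B) xi : R :=
  inf [set r | exists2 eta, W eta & r = rnorm (xi + eta)].

Definition spectral_gap_gt (E0 : set (X * X)) pi (c : R) : Prop :=
  exists2 c', c < c' & forall xi, quot_norm (invariants pi) xi = 1 ->
    exists V, [/\ partial_translation d V, supp V `<=` E0 &
      c' <= quot_norm (invariants pi) (pi V xi - pi (chiR V) xi)].

(* delta_B with values in \bar R, so that the infimum of the empty set (B = 0)
   is +oo *)
Definition convexity_modulus (t : R) : \bar R :=
  ereal_inf [set r | exists xi eta : B,
    [/\ rnorm xi = 1, rnorm eta = 1, t <= rnorm (xi - eta) &
        r = (1 - rnorm (xi + eta) / 2)%:E]].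

End Representations.
Arguments convexity_modulus {R} B t.

Section Families.
Context {R : realType}.
Local Notation C := R[i].
Context {I : Type} (BB : I -> completeNormedModType C).

Definition uniformly_convex_family : Prop :=
  forall t : R, 0 < t <= 2 ->
    (0 < ereal_inf (range (fun i => convexity_modulus (BB i) t)))%E.

Context {X : choiceType} (d : X -> X -> \bar R).
Local Notation M := (X -> X -> C).

Definition uniform_geometric_T (E0 : set (X * X)) : Prop :=
  exists2 c : R, 0 < c &
    forall i (pi : M -> BB i -> BB i), representation d pi ->
      spectral_gap_gt d E0 pi c.

(* The set below is bounded above by l1norm d a for a in Cu d; if there are no
   representations at all then maxnorm = 0. *)
Definition maxnorm (a : M) : R :=
  sup [set r | exists i (pi : M -> BB i -> BB i),
    representation d pi /\ r = opnorm (pi a)].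

Lemma CuB (a b : M) : Cu d a -> Cu d b -> Cu d (a - b).
Proof.
move=> [[K aK] [r ar]] [[L bL] [s bs]]; split.
  exists (K + L) => x y; apply: (le_trans (rnormD _ _)).
  by rewrite rnormN lerD.
exists (Num.max r s) => -[x y] /= abxy.
have [a0|a0] := eqVneq (a x y) 0.
  apply: (@le_trans _ _ s%:E); last by rewrite lee_fin le_max lexx orbT.
  by apply: (bs (x, y)) => /=; apply: contra abxy => /eqP b0;
    rewrite !fctE a0 b0 subrr.
apply: (@le_trans _ _ r%:E); last by rewrite lee_fin le_max lexx.
exact: (ar (x, y)).
Qed.

Lemma Cu0 : Cu d (0 : M).
Proof.
split; exists 0; first by move=> x y; rewrite rnorm0.
by move=> [x y] /=; rewrite /supp /= eqxx.
Qed.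

Section Seminorm.
Context (i : I) (pi : M -> BB i -> BB i).
Context (pi_rep : representation d pi).

Lemma opnorm_has_sup (T : M) : Cu d T ->
  has_sup [set r | exists2 xi, rnorm xi <= 1 & r = rnorm (pi T xi)].
Proof.
move=> CT; split; first by exists (rnorm (pi T 0)); exists 0; rewrite ?rnorm0.
pose g : {linear BB i -> BB i} :=
  HB.pack (pi T) (GRing.isLinear.Build _ _ _ _ _ (rep_linear pi_rep CT)).
have /linear_boundedP/pinfty_ex_gt0 [K K0 gK] : bounded_near g (nbhs 0).
  exact/linear_bounded_continuous/(rep_continuous pi_rep CT).
exists (complex.Re K) => _ [xi xi1 ->].
have KE : (complex.Re K)%:C = K by rewrite RRe_real // gtr0_real.
rewrite -lecR KE rnormE (le_trans (gK xi)) // ler_piMr ?(ltW K0)//.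
by rewrite -rnormE lecR.
Qed.

Lemma opnorm_ub (T : M) xi : Cu d T -> rnorm xi <= 1 ->
  rnorm (pi T xi) <= opnorm (pi T).
Proof.
move=> CT xi1; apply: ub_le_sup; last by exists xi.
by have [] := opnorm_has_sup CT.
Qed.

Lemma opnormP (T : M) xi : Cu d T ->
  rnorm (pi T xi) <= opnorm (pi T) * rnorm xi.
Proof.
move=> CT; pose g : {linear BB i -> BB i} :=
  HB.pack (pi T) (GRing.isLinear.Build _ _ _ _ _ (rep_linear pi_rep CT)).
have [->|xi0] := eqVneq xi 0.
  by rewrite (linear0 g : pi T 0 = 0) !rnorm0 mulr0.
have n0 : 0 < rnorm xi by rewrite -ltcR rnormE normr_gt0.
pose c : C := (rnorm xi)%:C.
have c0 : c != 0 by rewrite /c rnormE normr_eq0.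
have := opnorm_ub (xi := c^-1 *: xi) CT.
have -> : pi T (c^-1 *: xi) = c^-1 *: pi T xi by exact: (linearZZ g).
have rZ (v : BB i) : rnorm (c^-1 *: v) = (rnorm xi)^-1 * rnorm v.
  apply: (@complexI R); rewrite rmorphM fmorphV /= !(rnormE (_ *: v)) (rnormE v).
  by rewrite normrZ normfV ger0_norm // /c lecR rnorm_ge0.
rewrite !rZ mulVf ?gt_eqF// lexx => /(_ isT).
by rewrite mulrC ler_pdivrMr.
Qed.

Lemma opnorm_ge0 (T : M) : Cu d T -> 0 <= opnorm (pi T).
Proof.
move=> CT; apply: le_trans (rnorm_ge0 (pi T 0)) _.
by apply: opnorm_ub; rewrite ?rnorm0.
Qed.

Lemma repB (a b : M) xi : Cu d a -> Cu d b ->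
  pi (a - b) xi = pi a xi - pi b xi.
Proof.
by move=> Ca Cb; rewrite addrC -scaleN1r (repP pi_rep) // scaleN1r addrC.
Qed.

Lemma opnormB (a b : M) : Cu d a -> Cu d b ->
  opnorm (pi (a - b)) <= opnorm (pi a) + opnorm (pi b).
Proof.
move=> Ca Cb; apply: ge_sup; first by have [] := opnorm_has_sup (CuB Ca Cb).
move=> _ [xi xi1 ->]; rewrite repB //; apply: le_trans (rnormD _ _) _.
by rewrite rnormN lerD // opnorm_ub.
Qed.

End Seminorm.

Let maxnorm_set (a : M) := [set r | exists i (pi : M -> BB i -> BB i),
  representation d pi /\ r = opnorm (pi a)].

Let maxnorm_ubound (a : M) : Cu d a -> has_ubound (maxnorm_set a).
Proof.
by move=> Ca; exists (l1norm d a) => _ [i [pi [pir ->]]]; exact: rep_bound.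
Qed.

Lemma maxnorm_ub (a : M) i (pi : M -> BB i -> BB i) :
  Cu d a -> representation d pi -> opnorm (pi a) <= maxnorm a.
Proof.
by move=> Ca pir; apply: ub_le_sup; [exact: maxnorm_ubound|exists i, pi].
Qed.

Lemma maxnorm_le (a : M) (r : R) : 0 <= r ->
  (forall i (pi : M -> BB i -> BB i), representation d pi -> opnorm (pi a) <= r) ->
  maxnorm a <= r.
Proof.
move=> r0 ar; have [a0|a0] := pselect (maxnorm_set a !=set0).
  by apply: ge_sup => // _ [i [pi [pir ->]]]; exact: ar.
by rewrite /maxnorm -/(maxnorm_set a) (_ : maxnorm_set a = set0) ?sup0//;
  apply/eqP/negPn/negP => /set0P.
Qed.

Lemma maxnorm_ge0 (a : M) : Cu d a -> 0 <= maxnorm a.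
Proof.
move=> Ca; have [[r [i [pi [pir _]]]]|a0] := pselect (maxnorm_set a !=set0).
  exact: le_trans (opnorm_ge0 pir Ca) (maxnorm_ub Ca pir).
by rewrite /maxnorm -/(maxnorm_set a) (_ : maxnorm_set a = set0) ?sup0//;
  apply/eqP/negPn/negP => /set0P.
Qed.

Lemma maxnormB (a b : M) : Cu d a -> Cu d b ->
  maxnorm (a - b) <= maxnorm a + maxnorm b.
Proof.
move=> Ca Cb; apply: maxnorm_le => [|i pi pir].
  by rewrite addr_ge0 ?maxnorm_ge0.
by rewrite (le_trans (opnormB pir Ca Cb))// lerD// maxnorm_ub.
Qed.

Lemma maxnorm0 : maxnorm 0 = 0.
Proof.
apply/eqP; rewrite eq_le maxnorm_ge0 ?andbT; last exact: Cu0.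
apply: maxnorm_le => // i pi pir; apply: ge_sup => [|_ [xi _ ->]].
  by have [] := opnorm_has_sup pir Cu0.
by rewrite -(subrr 0) repB ?subrr ?rnorm0//; exact: Cu0.
Qed.

(* C_{B,max}(X), the completion of Cu d in the (semi)norm maxnorm: Cauchy
   sequences modulo null sequences. *)

Definition cauchy_seq : {pred nat -> M} := fun u =>
  `[< (forall k, Cu d (u k)) /\
      forall e : R, 0 < e -> exists N, forall m n, (N <= m)%N -> (N <= n)%N ->
        maxnorm (u m - u n) < e >].

Lemma cauchy_seq_zmod : zmod_closed cauchy_seq.
Proof.
split=> [|u v /asboolP[Cuu cu] /asboolP[Cv cv]]; apply/asboolP; split.
- by move=> k; exact: Cu0.
- by move=> e e0; exists 0 => m n _ _; rewrite (_ : _ - _ = 0) ?maxnorm0//; exact: subrr.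
- by move=> k; exact: CuB.
move=> e e0; have e20 : 0 < e / 2 by rewrite divr_gt0.
have [N1 h1] := cu _ e20; have [N2 h2] := cv _ e20.
exists (maxn N1 N2) => m n; rewrite !geq_max => /andP[m1 m2] /andP[n1 n2].
have -> : (u - v) m - (u - v) n = (u m - u n) - (v m - v n).
  change (u m - v m - (u n - v n) = u m - u n - (v m - v n)).
  by rewrite opprD addrACA -opprD.
rewrite (le_lt_trans (maxnormB (CuB _ _) (CuB _ _)))//.
by rewrite [ltRHS]splitr ltrD ?h1 ?h2.
Qed.
HB.instance Definition _ :=
  GRing.isZmodClosed.Build (nat -> M) cauchy_seq cauchy_seq_zmod.

Record cauchy_type := Cauchy
  { cauchy_val :> nat -> M ; cauchy_valP : cauchy_val \in cauchy_seq }.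
HB.instance Definition _ := [isSub for cauchy_val].
HB.instance Definition _ := [Choice of cauchy_type by <:].
HB.instance Definition _ := [SubChoice_isSubZmodule of cauchy_type by <:].

Definition null_seq : {pred cauchy_type} := fun u =>
  `[< (fun k => maxnorm (u k)) @ \oo --> (0 : R) >].

Lemma null_seq_zmod : zmod_closed null_seq.
Proof.
split=> [|u v /asboolP u0 /asboolP v0]; apply/asboolP.
  by under eq_fun do rewrite maxnorm0; exact: cvg_cst.
have /asboolP[Cuu _] := cauchy_valP u; have /asboolP[Cv _] := cauchy_valP v.
apply: (@squeeze_cvgr _ _ _ _ (cst 0) (fun k => maxnorm (u k) + maxnorm (v k))).
- by near=> k; rewrite maxnorm_ge0 ?maxnormB//; exact: CuB.
- exact: cvg_cst.
- by rewrite -[X in _ --> X](addr0 0); exact: cvgD.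
Unshelve. all: by end_near. Qed.
HB.instance Definition _ :=
  GRing.isZmodClosed.Build cauchy_type null_seq null_seq_zmod.

Definition Cmax := Quotient.quot null_seq.
HB.instance Definition _ := Quotient.on Cmax.
HB.instance Definition _ := GRing.Zmodule.on Cmax.

Definition cauchy_rep (p : Cmax) : cauchy_type := repr p.

(* norm of the completion; independent of the representative *)
Definition Cmax_norm (p : Cmax) : R := limn (fun k => maxnorm (cauchy_rep p k)).

(* extension of the representation pi to the completion; independent of the
   representative *)
Definition Cmax_ext i (pi : M -> BB i -> BB i) (p : Cmax) (xi : BB i) : BB i :=
  limn (fun k => pi (cauchy_rep p k) xi).

Lemma cauchy_cstP (a : M) : Cu d a -> (fun=> a) \in cauchy_seq.
Proof.
move=> Ca; apply/asboolP; split=> // e e0.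
by exists 0 => m n _ _; rewrite subrr maxnorm0.
Qed.

(* image in the completion of a in Cu d: class of the constant sequence a (the
   value 0 for a outside Cu d is a dummy) *)
Definition Cmax_of (a : M) : Cmax :=
  if pselect (Cu d a) is left Ca
  then (\pi_Cmax (Cauchy (cauchy_cstP Ca)))%qT else 0.

Lemma cauchy_rep_Cmax_of (a : M) : Cu d a ->
  (fun k => maxnorm (cauchy_rep (Cmax_of a) k - a)) @ \oo --> (0 : R).
Proof.
move=> Ca; rewrite /Cmax_of; case: pselect => // Ca'.
set c := Cauchy _.
have : cauchy_rep (\pi_Cmax c)%qT - c \in null_seq.
  by rewrite Quotient.idealrBE reprK.
by move/asboolP.
Qed.

Lemma cauchy_repP (p : Cmax) k : Cu d (cauchy_rep p k).
Proof. by have /asboolP[] := cauchy_valP (cauchy_rep p). Qed.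

Lemma Cmax_norm_of (a : M) : Cu d a -> Cmax_norm (Cmax_of a) = maxnorm a.
Proof.
move=> Ca; apply: cvg_lim => //; set u := cauchy_rep _.
have Cuu k : Cu d (u k) by exact: cauchy_repP.
have N0 (b : M) : Cu d b -> maxnorm (- b) <= maxnorm b.
  move=> Cb; rewrite -sub0r (le_trans (maxnormB Cu0 Cb))//.
  by rewrite maxnorm0 add0r.
apply/cvgrPdist_le => e e0.
have /cvgrPdist_le/(_ _ e0) := cauchy_rep_Cmax_of Ca; apply: filterS => k.
have CB := CuB (Cuu k) Ca.
rewrite sub0r normrN (ger0_norm (maxnorm_ge0 CB)) => ke.
rewrite ler_distlC; apply/andP; split.
  rewrite lerBlDr -[X in maxnorm X](subKr (u k)).
  by rewrite (le_trans (maxnormB (Cuu k) CB))// lerD2l.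
rewrite -[X in maxnorm X](subrK a) -[X in _ + X]opprK.
have CN : Cu d (- a) by rewrite -sub0r; exact: CuB Cu0 Ca.
by rewrite (le_trans (maxnormB CB CN))// addrC lerD// N0.
Qed.

Lemma Cmax_ext_of i (pi : M -> BB i -> BB i) (a : M) xi :
  representation d pi -> Cu d a -> Cmax_ext pi (Cmax_of a) xi = pi a xi.
Proof.
move=> pir Ca; apply: cvg_lim; first exact: norm_hausdorff.
set u := cauchy_rep _; have Cuu k : Cu d (u k) by exact: cauchy_repP.
apply/cvgrPdist_le => e e0; have eE : (complex.Re e)%:C = e.
  by rewrite RRe_real // gtr0_real.
have e1 : 0 < complex.Re e / (1 + rnorm xi).
  by rewrite divr_gt0 ?ltr_wpDr ?rnorm_ge0// -ltcR eE.
have /cvgrPdist_le/(_ _ e1) := cauchy_rep_Cmax_of Ca; apply: filterS => k.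
have CB := CuB (Cuu k) Ca.
rewrite sub0r normrN (ger0_norm (maxnorm_ge0 CB)) => ke.
rewrite distrC -(repB pir)// -rnormE -eE lecR.
rewrite (le_trans (opnormP pir _ CB))//.
apply: (@le_trans _ _ (maxnorm (u k - a) * (1 + rnorm xi))); last first.
  by rewrite -ler_pdivlMr// ltr_wpDr ?rnorm_ge0.
by rewrite ler_pM ?rnorm_ge0 ?(opnorm_ge0 pir)// ?maxnorm_ub// lerDr.
Qed.

End Families.

Section Kazhdan.
Context {R : realType} {X : choiceType} (d : X -> X -> \bar R).
Local Notation C := R[i].
Local Notation M := (X -> X -> C).

Definition generating_translations (E0 : set (X * X)) n (A : 'I_n -> M) : Prop :=
  [/\ (0 < n)%N,
      forall i, full_partial_translation d (A i) /\ supp (A i) `<=` E0 &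
      forall V, partial_translation d V -> supp V `<=` E0 ->
        exists2 Bs : 'I_n -> set X, trivIset setT Bs &
          V = \sum_i mmul (diag \1_(Bs i)) (A i)].

Definition averaging n (A : 'I_n -> M) : M :=
  n%:R^-1 *: \sum_i (2^-1 *: (mone + A i)).

Context {I : Type} (BB : I -> completeNormedModType C).

Definition kazhdan_projection n (A : 'I_n -> M) (p : Cmax BB d) : Prop :=
  let rate k := Cmax_norm (Cmax_of BB d (mpow (averaging A) k) - p) in
  [/\ forall i (pi : M -> BB i -> BB i), representation d pi ->
        forall xi, Cmax_ext pi p xi = invproj d pi xi,
      rate @ \oo --> (0 : R) &
      cvgn (series (fun k => rate k.+1))].

End Kazhdan.

(* Main.v *)
(* For a representation pi write P_k = pi(A)^k.

   From the gap to the projection: partial translations supported in E0 are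
   combinations of the A_i with diagonal contractions as coefficients, so a
   spectral gap makes some A_i move xi by a fixed fraction of its norm in
   B/B^pi.  Uniform convexity then makes pi(A) a strict contraction of B/B^pi,
   with a ratio rho common to all representations, and since 1 - pi(A) kills
   B^pi, ||P_{k+1} - P_k|| <= 2 rho^k.  Hence A^k converges in the completion at
   a geometric rate, and P_k tends to a projection P onto B^pi.

   The delicate point is that P vanishes on B_pi and not merely that P is some
   projection onto B^pi; equivalently P A_i = P.  The relation P A = P says that
   w |-> P w xi is harmonic for the random walk generated by the A_i.  If
   P A_i <> P, the martingale differences of this harmonic function, paired with
   suitable vectors, yield B-valued martingales of length N with bounded
   differences and mean norm at least c N.  Uniform convexity of L^2(B) bounds
   the L^2 norm of the sum of two consecutive blocks of equal norm by
   2 (1 - e) times the norm of a block, so these norms grow like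
   (2 (1 - e))^k for N = 2^k, a contradiction.

   Conversely, if ||A^m - p|| <= 1/2 then xi - P_m xi has norm at least 1/2 in
   B/B^pi for unit classes [xi], and telescoping gives an i for which
   xi - A_i xi has norm at least 1/(2m) there. *)

Require Import Defs.
From HB Require Import structures.
From mathcomp Require Import all_boot all_order all_algebra.
From mathcomp Require Import complex ring lra.
From mathcomp Require Import all_classical all_reals all_analysis.
Set Implicit Arguments.
Unset Strict Implicit.
Unset Printing Implicit Defensive.
Import Order.TTheory GRing.Theory Num.Theory.
Import numFieldNormedType.Exports.
Local Open Scope classical_set_scope.
Local Open Scope complex_scope.
Local Open Scope ring_scope.

(** * Complex norms and the Hahn-Banach theorem *)

Section RealNorm.
Context {R : realType} {V : normedModType R[i]}.
Implicit Types (u v : V) (r : R).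

Lemma ge0_rnorm_scale r v : 0 <= r -> rnorm (r%:C *: v) = r * rnorm v.
Proof.
move=> r0; apply: (@complexI R).
by rewrite rmorphM /= !rnormE normrZ ger0_norm // lecR.
Qed.

Lemma rnorm_imaginary v : rnorm ('i%C *: v) = rnorm v.
Proof.
by rewrite /rnorm normrZ normc_def /= expr0n add0r expr1n sqrtr1 mul1r.
Qed.

Lemma rnormB u v : rnorm (u - v) <= rnorm u + rnorm v.
Proof. by rewrite (le_trans (rnormD _ _)) ?rnormN. Qed.

Lemma rnorm_distC u v : rnorm (u - v) = rnorm (v - u).
Proof. by rewrite -rnormN opprB. Qed.

Lemma rnorm_eq0 v : rnorm v = 0 -> v = 0.
Proof. by move=> v0; apply/eqP; rewrite -normr_eq0 -rnormE v0. Qed.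

Lemma rnorm_gt0 v : v != 0 -> 0 < rnorm v.
Proof.
move=> v0; rewrite lt_neqAle rnorm_ge0 andbT eq_sym.
by apply: contra v0 => /eqP/rnorm_eq0/eqP.
Qed.

Lemma rnorm_sum (J : Type) (s : seq J) (F : J -> V) :
  rnorm (\sum_(j <- s) F j) <= \sum_(j <- s) rnorm (F j).
Proof.
elim: s => [|j s IH]; first by rewrite !big_nil rnorm0.
by rewrite !big_cons (le_trans (rnormD _ _)) // lerD2l.
Qed.

End RealNorm.

(** * The real Hahn-Banach theorem through minimal sublinear functionals *)

Section Sublinear.
Context {R : realType} {V : lmodType R[i]}.
Implicit Types (p q : V -> R) (x y : V) (t : R).

Definition sublinear p : Prop :=
  (forall x y, p (x + y) <= p x + p y) /\
  (forall t x, 0 < t -> p (t%:C *: x) = t * p x).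

Lemma sublinear0 p : sublinear p -> p 0 = 0.
Proof.
move=> [pD pZ]; have := pZ 2 0 (ltr0Sn _ 1); rewrite scaler0 => h; lra.
Qed.

Lemma sublinear_oppr p x : sublinear p -> - p (- x) <= p x.
Proof.
move=> ps; have := ps.1 x (- x); rewrite subrr sublinear0// => h; lra.
Qed.

(** The largest sublinear functional below [p] whose value at [- y] is at most [- p y]: any such [q]
    satisfies [q x <= q (x + t y) + t q (- y)]. Comparing a minimal functional with its tilts forces
    it to be odd. *)
Definition tilt p y x : R :=
  inf [set p (x + t%:C *: y) - t * p y | t in [set t | 0 <= t]].

Lemma sublinear_scale_ge0 p t y : sublinear p -> 0 <= t ->
  p (t%:C *: y) = t * p y.
Proof.
move=> ps; rewrite le_eqVlt => /predU1P[<-|]; last exact: ps.2.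
by rewrite scale0r sublinear0// mul0r.
Qed.

Lemma tilt_lbound p y x : sublinear p ->
  lbound [set p (x + t%:C *: y) - t * p y | t in [set t | 0 <= t]] (- p (- x)).
Proof.
move=> ps _ [t /= t0 <-]; rewrite -sublinear_scale_ge0//.
have := ps.1 (x + t%:C *: y) (- x); rewrite addrAC subrr add0r => h; lra.
Qed.

Lemma tilt_le p y x t : sublinear p -> 0 <= t ->
  tilt p y x <= p (x + t%:C *: y) - t * p y.
Proof.
move=> ps t0; apply: ge_inf; last by exists t.
by exists (- p (- x)); exact: tilt_lbound.
Qed.

Lemma le_tilt p y x r : sublinear p ->
  (forall t, 0 <= t -> r <= p (x + t%:C *: y) - t * p y) -> r <= tilt p y x.
Proof.
move=> ps h; apply: lb_le_inf; last by move=> _ [t t0 <-]; exact: h.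
by exists (p (x + 0%:C *: y) - 0 * p y); exists 0 => //=.
Qed.

Lemma tilt_lep p y x : sublinear p -> tilt p y x <= p x.
Proof.
move=> ps; have := @tilt_le p y x 0 ps (lexx 0).
by rewrite scale0r addr0 mul0r subr0.
Qed.

Lemma tilt_oppr p y : sublinear p -> tilt p y (- y) <= - p y.
Proof.
move=> ps; have := @tilt_le p y (- y) 1 ps ler01.
by rewrite scale1r addNr sublinear0// mul1r add0r.
Qed.

Lemma tilt_sublinear p y : sublinear p -> sublinear (tilt p y).
Proof.
move=> ps; split=> [x z|t x t0].
  rewrite -lerBlDr; apply: le_tilt => // t t0.
  rewrite lerBlDr -lerBlDl; apply: le_tilt => // s s0.
  rewrite lerBlDl.
  apply: le_trans (@tilt_le _ _ _ (s + t) ps _) _; first exact: addr_ge0.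
  have := ps.1 (x + t%:C *: y) (z + s%:C *: y).
  rewrite addrACA -scalerDl -rmorphD /= (addrC t s) => h; lra.
have tI : 0 < t^-1 by rewrite invr_gt0.
have K s a b : 0 < s -> 0 <= a -> s * (p (b + a%:C *: y) - a * p y) =
    p (s%:C *: b + (s * a)%:C *: y) - (s * a) * p y.
  by move=> s0 a0; rewrite mulrBr -ps.2// scalerDr scalerA -rmorphM mulrA.
apply/eqP; rewrite eq_le; apply/andP; split.
  rewrite -ler_pdivrMl//; apply: le_tilt => // a a0.
  rewrite ler_pdivrMl// K//; apply: tilt_le => //.
  by rewrite mulr_ge0// ltW.
apply: le_tilt => // a a0; rewrite -ler_pdivlMl// K//.
rewrite scalerA -rmorphM /= mulVf ?gt_eqF// scale1r.
by apply: tilt_le => //; rewrite mulr_ge0// ltW.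
Qed.

(** Zorn's lemma for the reversed pointwise order. The infimum of a chain is finite because
    [- p (- x)] bounds every member from below, and it is subadditive because of any two members one
    lies below the other and can replace it. The empty chain is bounded by [p] itself. *)
Lemma minimal_sublinear p : sublinear p ->
  exists2 f, sublinear f /\ (forall x, f x <= p x) &
    forall q, sublinear q -> (forall x, q x <= f x) -> q = f.
Proof.
move=> ps; pose T := {q : V -> R | sublinear q /\ forall x, q x <= p x}.
pose le_rel : rel T := fun a b => `[< forall x, sval b x <= sval a x >].
have [||||[f [fs fp]] fmin] := @Zorn T le_rel.
- by move=> q; apply/asboolP.
- by move=> q r s /asboolP qr /asboolP rs; apply/asboolP => x; 
  exact: le_trans (rs x) (qr x).
- move=> [q [qs qp]] [r [rs rp]] /asboolP/= qr /asboolP/= rq.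
  by apply: eq_exist => /=; apply/funext => x; apply/eqP; rewrite eq_le qr rq.
- move=> A Atot; have [[a Aa]|A0] := pselect (A !=set0); last first.
    by exists (exist _ p (conj ps (fun x => lexx _))) => s As; case: A0; exists s.
  pose E x := [set sval b x | b in A].
  have Elb x : lbound (E x) (- p (- x)).
    move=> _ [[q [qs qp]] Aq <-] /=; apply: le_trans (sublinear_oppr x qs).
    by rewrite lerN2.
  have E0 x : E x !=set0 by exists (sval a x); exists a.
  have Ele b x : A b -> inf (E x) <= sval b x.
    by move=> Aq; apply: ge_inf; [exists (- p (- x)); exact: Elb|exists b].
  have leE x r : (forall b, A b -> r <= sval b x) -> r <= inf (E x).
    by move=> h; apply: lb_le_inf => // _ [q Aq <-]; exact: h.
  have infE : sublinear (fun x => inf (E x)) /\ forall x, inf (E x) <= p x.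
    split; last by move=> x; apply: le_trans (Ele a x Aa) _; exact: (svalP a).2.
    split=> [x y|t x t0].
      rewrite -lerBlDr; apply: (leE) => q Aq; rewrite lerBlDr -lerBlDl.
      apply: (leE) => r Ar; rewrite lerBlDl.
      have [/asboolP qr|/asboolP rq] := Atot q r Aq Ar.
        apply: le_trans (Ele r _ Ar) _; apply: le_trans ((svalP r).1.1 _ _) _.
        by rewrite lerD2r; exact: qr.
      apply: le_trans (Ele q _ Aq) _; apply: le_trans ((svalP q).1.1 _ _) _.
      by rewrite lerD2l; exact: rq.
    apply/eqP; rewrite eq_le; apply/andP; split.
      rewrite -ler_pdivrMl//; apply: (leE) => q Aq; rewrite ler_pdivrMl//.
      by rewrite -(svalP q).1.2//; exact: Ele.
    apply: (leE) => q Aq; rewrite (svalP q).1.2// ler_pM2l//; exact: Ele.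
  exists (exist (fun g => sublinear g /\ forall x, g x <= p x) _ infE : T).
  by move=> q Aq; apply/asboolP => x /=; exact: Ele.
exists f => // q qs qf.
have qp x : q x <= p x by exact: le_trans (qf x) (fp x).
have := fmin (exist _ q (conj qs qp)).
by move=> h; have /(congr1 sval) := h (asboolT qf).
Qed.

(* A minimal sublinear functional equals each of its tilts, hence is odd, hence
   additive. *)
Lemma real_hahn_banach p x0 : sublinear p ->
  exists f : V -> R, [/\ forall x y, f (x + y) = f x + f y,
    forall t x, f (t%:C *: x) = t * f x, forall x, f x <= p x &
    p x0 <= f x0].
Proof.
move=> ps; have ts := tilt_sublinear x0 ps.
(* Minimising below [tilt p x0] instead of [p] gives [f (- x0) <= - p x0], so that the oddness of
   [f] makes it reach [p x0] at [x0]. *)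
have [f [fs ft] fmin] := minimal_sublinear ts.
have fN x : f (- x) = - f x.
  apply/eqP; rewrite eq_le -{1}(fmin _ (tilt_sublinear x fs)); last first.
    by move=> y; exact: tilt_lep.
  by rewrite tilt_oppr//= lerNl sublinear_oppr.
exists f; split.
- move=> x y; apply/eqP; rewrite eq_le fs.1/=.
  have := fs.1 (x + y) (- y); rewrite addrK fN => h; lra.
- move=> t x; have [t0|t0|->] := ltgtP t 0; last 2 first.
  + exact: fs.2.
  + by rewrite scale0r sublinear0// mul0r.
  rewrite -[t]opprK rmorphN scaleNr fN fs.2 ?oppr_gt0//; lra.
- by move=> x; apply: le_trans (ft x) _; exact: tilt_lep.
have := ft (- x0); have := tilt_oppr x0 ps; rewrite fN => h1 h2; lra.
Qed.

End Sublinear.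

(** A real functional [f] dominated by the norm and norming [x0] is complexified to
    [g x = f x - i f (i x)]; the real part of [g x0] is then positive. *)
Lemma exists_dual_neq0 (R : realType) (B : completeNormedModType R[i]) (x0 : B) :
  x0 != 0 -> exists2 f : B -> R[i]^o, dual_space f & f x0 != 0.
Proof.
move=> x00.
have [|f [fD fZ fle fx0]] := @real_hahn_banach R B (@rnorm R B) x0.
  by split=> [x y|t x t0]; [exact: rnormD|rewrite ge0_rnorm_scale// ltW].
pose g (x : B) : R[i]^o := (f x)%:C - 'i%C * (f ('i%C *: x))%:C.
have fN x : f (- x) = - f x.
  by have := fZ (-1) x; rewrite rmorphN scaleN1r mulN1r.
have fi (x : B) : f ('i%C *: ('i%C *: x)) = - f x.
  by rewrite scalerA -expr2 sqr_i scaleN1r fN.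
have gD x y : g (x + y) = g x + g y.
  by rewrite /g scalerDr !fD !rmorphD /=; ring.
have gZ c x : g (c *: x) = c * g x.
  have gr r z : g (r%:C *: z) = r%:C * g z.
    have -> : g (r%:C *: z) = (f (r%:C *: z))%:C -
        'i%C * (f (r%:C *: ('i%C *: z)))%:C.
      by rewrite /g !scalerA (mulrC r%:C).
    by rewrite !fZ !rmorphM /= /g; ring.
  have gi z : g ('i%C *: z) = 'i%C * g z.
    by rewrite /g fi rmorphN /= mulrBr mulrA -expr2 sqr_i; ring.
  rewrite {1}(complexE c) scalerDl gD gr -scalerA gi gr mulrA -mulrDl.
  by rewrite -complexE.
have glin : linear g by move=> c x y; rewrite gD gZ.
exists g; last first.
  have f0 : 0 < f x0 by rewrite (lt_le_trans (rnorm_gt0 x00)).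
  apply/eqP => /(congr1 (@complex.Re R)); rewrite /g /= => h.
  by move: f0; rewrite (_ : f x0 = 0) ?ltxx//; move: h; lra.
split=> //.
pose h : {linear B -> R[i]^o} := HB.pack g (GRing.isLinear.Build _ _ _ _ _ glin).
apply: (@bounded_linear_continuous _ _ _ h).
have fb x : `|f x| <= rnorm x.
  by rewrite ler_norml fle andbT lerNl -fN (le_trans (fle _))// rnormN.
apply/linear_boundedP.
(* The crude bound 2 comes from estimating [f x] and [f (i x)] separately; continuity asks for no
   more. *)
exists 2; split; first exact: realn.
move=> M M2 x; rewrite /= (le_trans (ler_normB _ _))//.
rewrite normrM (normc_def 'i%C) /= expr0n add0r expr1n sqrtr1 mul1r.
have e r : `|r%:C| = (`|r|)%:C :> R[i] by rewrite normc_def /= expr0n addr0 sqrtr_sqr.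
rewrite !e -rmorphD /= (@le_trans _ _ (2 * `|x|))//; last first.
  by rewrite ler_wpM2r// ltW.
rewrite -rnormE (_ : 2 = 2%:C); last by rewrite rmorph_nat.
rewrite -rmorphM lecR; have := fb x; have := fb ('i%C *: x).
by rewrite rnorm_imaginary; lra.
Qed.

(** * Uniform convexity *)

Section UniformConvexity.
Context {R : realType} {I : Type} (BB : I -> completeNormedModType R[i]).

(** Rescaling to the unit sphere reduces to the modulus of convexity; [e] lies below the infimum of
    the moduli and thus serves all members of the family. *)
Lemma uniform_convexity_ball (t : R) : uniformly_convex_family BB -> 0 < t ->
  exists2 e : R, 0 < e < 1 & forall i (u v : BB i), rnorm v = rnorm u ->
    t * rnorm u <= rnorm (u - v) -> rnorm (u + v) <= 2 * (1 - e) * rnorm u.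
Proof.
(* The moduli are controlled on []0, 2]] only, and decreasing [t] weakens the separation that has to
   be checked. *)
move=> uc t0; pose t' := Num.min t 2.
have t'0 : 0 < t' <= 2 by rewrite lt_min t0 ge_min lexx orbT /= ltr0n.
have := uc _ t'0; set m := ereal_inf _ => m0.
(* The cap at 1/2 keeps [e] below 1 and also covers an infinite infimum, where no pair of vectors
   competes. *)
have [e e01 em] : exists2 e : R, 0 < e < 1 & (e%:E <= m)%E.
  move: m0; case: m => [r|_|//]; last first.
    by exists (1 / 2); [lra|exact: leey].
  rewrite lte_fin => r0; exists (Num.min r (1 / 2)).
    by rewrite lt_min r0 /= gt_min; apply/andP; split; [lra|apply/orP; right; lra].
  by rewrite lee_fin ge_min lexx.
exists e => // i u v vu tuv.
have [u0|u0] := eqVneq u 0.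
  have v0 : v = 0 by apply: rnorm_eq0; rewrite vu u0 rnorm0.
  by rewrite v0 u0 addr0 rnorm0 mulr0.
have nu := rnorm_gt0 u0; have nu' : 0 <= (rnorm u)^-1 by rewrite invr_ge0 ltW.
pose c := (rnorm u)^-1%:C.
have cu (w : BB i) : rnorm (c *: w) = rnorm w / rnorm u.
  by rewrite ge0_rnorm_scale// mulrC.
have : (e%:E <= (1 - rnorm (c *: u + c *: v) / 2)%:E)%E.
  apply: le_trans em _; apply: le_trans (ereal_inf_lbound _) _.
    by exists i.
  apply: ereal_inf_lbound; exists (c *: u), (c *: v); split=> //.
  - by rewrite cu divff// gt_eqF.
  - by rewrite cu vu divff// gt_eqF.
  rewrite -scalerBr cu ler_pdivlMr// (le_trans _ tuv)// ler_wpM2r ?(ltW nu)//.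
  by rewrite ge_min lexx.
rewrite lee_fin -scalerDr cu => h.
rewrite -ler_pdivrMr//; lra.
Qed.

(* The case distinction compares rnorm (u + v) with the parallelogram law: if
   the norms of u and v differ by a factor it is lossy, otherwise u and v can be
   rescaled to the same sphere. *)
Lemma uniform_convexity_parallelogram : uniformly_convex_family BB ->
  exists2 K : R, 1 <= K & forall i (u v : BB i),
    rnorm (u - v) ^+ 2 <= 4^-1 * (rnorm u ^+ 2 + rnorm v ^+ 2) +
      K * (2 * rnorm u ^+ 2 + 2 * rnorm v ^+ 2 - rnorm (u + v) ^+ 2).
Proof.
(* The separation 1/4 is what remains of [a / 2 < w] after [v] is moved by less than [a / 4] to the
   sphere of [u]. In [g] below, 1/32 serves norms that differ by a factor and [e] serves comparable
   norms. *)
move=> uc; have [|e /andP[e0 e1] eP] := @uniform_convexity_ball 4^-1 uc; first by lra.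
pose g : R := Num.min (1 / 32) e.
have g0 : 0 < g by rewrite lt_min e0 andbT; lra.
have [g32 ge] : g <= 1 / 32 /\ g <= e by rewrite !ge_min !lexx orbT.
exists (2 / g) => [|i]; first by rewrite ler_pdivlMr//; lra.
suff main (u v : BB i) : rnorm v <= rnorm u ->
    rnorm (u - v) ^+ 2 <= 4^-1 * (rnorm u ^+ 2 + rnorm v ^+ 2) +
      2 / g * (2 * rnorm u ^+ 2 + 2 * rnorm v ^+ 2 - rnorm (u + v) ^+ 2).
  move=> u v; have [uv|/ltW uv] := leP (rnorm u) (rnorm v); last exact: main.
  rewrite rnorm_distC [u + v]addrC [rnorm u ^+ 2 + _]addrC.
  by rewrite [2 * rnorm u ^+ 2 + _]addrC; exact: main.
move=> vu; set a := rnorm u in vu *; set b := rnorm v in vu *.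
have b0 : 0 <= b by exact: rnorm_ge0.
have sab : rnorm (u + v) <= a + b by exact: rnormD.
have dab : rnorm (u - v) <= a + b by exact: rnormB.
have s0 : 0 <= rnorm (u + v) by exact: rnorm_ge0.
have d0 : 0 <= rnorm (u - v) by exact: rnorm_ge0.
set s := rnorm (u + v) in sab s0 *; set w := rnorm (u - v) in dab d0 *.
have s2 : s ^+ 2 <= (a + b) ^+ 2 by rewrite lerXn2r ?nnegrE ?addr_ge0// (le_trans b0).
have w2 : w ^+ 2 <= (a + b) ^+ 2 by rewrite lerXn2r ?nnegrE ?addr_ge0// (le_trans b0).
have ab2 : (a + b) ^+ 2 = 2 * (a ^+ 2 + b ^+ 2) - (a - b) ^+ 2 by ring.
have ab0 : 0 <= (a - b) ^+ 2 by exact: sqr_ge0.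
have K0 : 0 < 2 / g by rewrite divr_gt0.
have [wab|wab] := leP (w ^+ 2) (4^-1 * (a ^+ 2 + b ^+ 2)).
  apply: (le_trans wab); rewrite lerDl mulr_ge0 ?(ltW K0)//; lra.
(* Since [w ^+ 2] is at most twice [a ^+ 2 + b ^+ 2], the constant [2 / g] turns this gain into the
   claim. *)
suff gain : g * (a ^+ 2 + b ^+ 2) <= 2 * a ^+ 2 + 2 * b ^+ 2 - s ^+ 2.
  rewrite ler_wpDl//; first by rewrite mulr_ge0 ?addr_ge0 ?sqr_ge0//; lra.
  rewrite mulrAC ler_pdivlMr//; nra.
have a0 : 0 <= a by exact: le_trans vu.
have [bs|bl] := leP b (3 / 4 * a).
  have : (4^-1 * a) ^+ 2 <= (a - b) ^+ 2.
    by rewrite lerXn2r ?nnegrE//; lra.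
  have : g * (a ^+ 2 + b ^+ 2) <= 1 / 32 * (a ^+ 2 + b ^+ 2).
    by rewrite ler_wpM2r// addr_ge0 ?sqr_ge0.
  have : b ^+ 2 <= a ^+ 2 by rewrite lerXn2r ?nnegrE.
  rewrite exprMn; lra.
have a1 : 0 < a by lra.
have b1 : 0 < b by lra.
have wa : a / 2 < w.
  rewrite ltNge; apply/negP => wa.
  have : w ^+ 2 <= (a / 2) ^+ 2 by rewrite lerXn2r ?nnegrE//; lra.
  have := sqr_ge0 b; rewrite exprMn exprVn; lra.
(* [v] rescaled to the norm of [u], so that the uniform convexity of spheres applies to [u] and
   [v']. *)
pose v' := (a / b)%:C *: v.
have ab1 : 0 <= a / b by rewrite divr_ge0.
have v'a : rnorm v' = a by rewrite ge0_rnorm_scale// divfK ?gt_eqF.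
have vv' : rnorm (v' - v) = a - b.
  rewrite /v' -[X in _ - X]scale1r -scalerBl -[1](rmorph1 (real_complex R)).
  rewrite -rmorphB ge0_rnorm_scale; last by rewrite subr_ge0 ler_pdivlMr// mul1r.
  by rewrite mulrBl divfK ?gt_eqF// mul1r.
have h1 : rnorm (u + v') <= 2 * (1 - e) * a.
  apply: eP => //; have := rnormD (u - v') (v' - v).
  by rewrite addrA subrK vv' -/w -/a; lra.
(* From the identity [u + v = (b / a) (u + v') + (1 - b / a) u]. *)
have h2 : s <= b / a * rnorm (u + v') + (a - b).
  have ba0 : 0 <= b / a by rewrite divr_ge0.
  rewrite -ge0_rnorm_scale//.
  have -> : a - b = rnorm ((1 - b / a)%:C *: u).
    rewrite ge0_rnorm_scale; last by rewrite subr_ge0 ler_pdivrMr// mul1r.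
    by rewrite mulrBl divfK ?gt_eqF// mul1r.
  apply: le_trans (rnormD _ _); rewrite /v' scalerDr scalerA -rmorphM.
  rewrite mulf_div [b * a]mulrC divff ?scale1r; last by rewrite gt_eqF// mulr_gt0.
  by rewrite addrAC -scalerDl -rmorphD /= [X in X%:C]addrC subrK scale1r.
have h3 : s <= a + b - 2 * b * e.
  apply: (le_trans h2).
  have : b / a * rnorm (u + v') <= b / a * (2 * (1 - e) * a).
    by rewrite ler_wpM2l// divr_ge0.
  have -> : b / a * (2 * (1 - e) * a) = b * (2 * (1 - e)).
    by rewrite mulrA [_ * a]mulrC -!mulrA; field; rewrite gt_eqF.
  lra.
have h4 : s ^+ 2 <= (a + b) * (a + b - 2 * b * e).
  by rewrite expr2 ler_pM// (le_trans s0).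
have : g * (a ^+ 2 + b ^+ 2) <= e * (a ^+ 2 + b ^+ 2).
  by rewrite ler_wpM2r// addr_ge0 ?sqr_ge0.
have : e * (a ^+ 2 + b ^+ 2) <= e * (2 * b * (a + b)).
  by rewrite ler_wpM2l ?(ltW e0)//; nra.
nra.
Qed.

End UniformConvexity.

(** * Harmonic functions of a random walk by isometries *)

Lemma sumr_const_natl (R : pzSemiRingType) (J : finType) (x : R) :
  \sum_(j : J) x = #|J|%:R * x.
Proof. by rewrite sumr_const mulr_natl. Qed.

(** Expansion of a sum of squares [(a j - r) ^+ 2]. With the mean as [r] it becomes the
    Cauchy-Schwarz inequality; the walk uses another [r]. *)
Lemma sum_sqr_ge (R : realFieldType) (J : finType) (a : J -> R) (r : R) :
  2 * r * \sum_j a j - #|J|%:R * r ^+ 2 <= \sum_j a j ^+ 2.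
Proof.
rewrite -sumr_const_natl mulr_sumr -sumrB.
by apply: ler_sum => j _; have := sqr_ge0 (a j - r); rewrite sqrrB; lra.
Qed.

Lemma sqr_sum_le (R : realFieldType) (J : finType) (a : J -> R) :
  (\sum_j a j) ^+ 2 <= #|J|%:R * \sum_j a j ^+ 2.
Proof.
set t := \sum_j a j; have [J0|J0] := posnP #|J|.
  by rewrite /t big1 ?expr0n ?J0 ?mul0r// => j _; have := fintype0 j J0.
have N0 : 0 < #|J|%:R :> R by rewrite ltr0n.
have := sum_sqr_ge a (t / #|J|%:R); rewrite -/t.
rewrite -(ler_pM2l N0) => /(le_trans _); apply.
by rewrite le_eqVlt; apply/orP; left; apply/eqP; field; rewrite gt_eqF.
Qed.

Section HarmonicWalk.
Context {R : realType} {B : normedModType R[i]} (K : R) (P : {additive B -> B}).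
Hypothesis K1 : 1 <= K.
Hypothesis parallelogram : forall u v : B,
  rnorm (u - v) ^+ 2 <= 4^-1 * (rnorm u ^+ 2 + rnorm v ^+ 2) +
    K * (2 * rnorm u ^+ 2 + 2 * rnorm v ^+ 2 - rnorm (u + v) ^+ 2).
Hypothesis P_contr : forall x, rnorm (P x) <= rnorm x.

(** Summing the weakened parallelogram inequality over mean-zero increments saves [1 / (2 K)] out of
    4, a relative saving of [1 / (8 K)]. *)
Let q : R := 1 - (8 * K)^-1.

Let K0 : 0 < K. Proof. exact: lt_le_trans ltr01 K1. Qed.

Let q0 : 0 <= q.
Proof.
rewrite /q subr_ge0 invf_le1; first by have := K1; lra.
by rewrite mulr_gt0.
Qed.

Section Step.
Context (Om : finType) (W' : Om -> {additive B -> B}) (Z : Om -> B).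
Hypothesis W'_iso : forall w x, rnorm (W' w x) = rnorm x.
Hypothesis Z_mean : \sum_w Z w = 0.

(** For fixed [w1] the vectors [Z w1 - W' w1 (Z w2)] average to [Z w1], so their mean square norm is
    at least that of [Z w1]. The difference term of the parallelogram inequality is therefore not
    small, and the sum term loses a fixed proportion. *)
Lemma walk_step :
  \sum_(w : Om * Om) rnorm (Z w.1 + W' w.1 (Z w.2)) ^+ 2 <=
  4 * q * (#|Om|%:R * \sum_w rnorm (Z w) ^+ 2).
Proof.
set S := \sum_w rnorm (Z w) ^+ 2; set N : R := #|Om|%:R.
rewrite -(pair_bigA _ (fun w1 w2 => rnorm (Z w1 + W' w1 (Z w2)) ^+ 2))/=.
pose T w1 := \sum_w2 rnorm (Z w1 + W' w1 (Z w2)) ^+ 2.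
have row w1 : N * rnorm (Z w1) ^+ 2 <=
    4^-1 * (N * rnorm (Z w1) ^+ 2 + S) +
    K * (2 * N * rnorm (Z w1) ^+ 2 + 2 * S - T w1).
  pose U := Z w1; pose D w2 := rnorm (U - W' w1 (Z w2)).
  have lbD : N * rnorm U <= \sum_w D w.
    have -> : N * rnorm U = rnorm (\sum_w2 (U - W' w1 (Z w2))).
      rewrite sumrB sumr_const -raddf_sum Z_mean raddf0 subr0.
      rewrite -[in RHS]scaler_nat -(rmorph_nat (real_complex R)).
      by rewrite ge0_rnorm_scale.
    exact: rnorm_sum.
  have U0 : 0 <= rnorm U by exact: rnorm_ge0.
  have h1 : N * rnorm U ^+ 2 <= \sum_w D w ^+ 2.
    apply: le_trans (sum_sqr_ge D (rnorm U)); rewrite -/N.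
    have : rnorm U * (N * rnorm U) <= rnorm U * \sum_w D w by rewrite ler_wpM2l.
    by rewrite expr2; lra.
  apply: (le_trans h1).
  apply: (@le_trans _ _ (\sum_w2 (4^-1 * (rnorm U ^+ 2 + rnorm (Z w2) ^+ 2) +
      K * (2 * rnorm U ^+ 2 + 2 * rnorm (Z w2) ^+ 2
           - rnorm (U + W' w1 (Z w2)) ^+ 2)))).
    by apply: ler_sum => w2 _; rewrite -(W'_iso w1 (Z w2)); exact: parallelogram.
  rewrite big_split/= -!mulr_sumr sumrB !big_split/= !sumr_const_natl -!mulr_sumr.
  by rewrite -/S -/(T w1) /N /U [_ * (2 * _)]mulrCA mulrA.
have : \sum_w1 N * rnorm (Z w1) ^+ 2 <= \sum_w1
    (4^-1 * (N * rnorm (Z w1) ^+ 2 + S) +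
     K * (2 * N * rnorm (Z w1) ^+ 2 + 2 * S - T w1)).
  by apply: ler_sum => w1 _; exact: row.
rewrite big_split/= -!mulr_sumr sumrB !big_split/= !sumr_const_natl -!mulr_sumr.
rewrite -/S -/N => h.
rewrite -/T -(ler_pM2l K0).
have -> : K * (4 * q * (N * S)) = 4 * K * (N * S) - 2^-1 * (N * S).
  by rewrite /q; field; rewrite gt_eqF.
move: h; set NS := N * S; set T' := \sum_w1 T w1.
have -> : 2 * N * S = 2 * NS by rewrite /NS mulrA.
have -> : N * (2 * S) = 2 * NS by rewrite /NS mulrCA.
lra.
Qed.

End Step.

(* Passing from Om to Om * Om doubles the left-hand sum per point, whereas the
   L^2 norm of the increments grows by a factor strictly below 2; iterating k
   times yields the factor q ^+ k. *)
Lemma walk_bound k (Om : finType) (W W' : Om -> {additive B -> B}) (Z : Om -> B) :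
  (forall w x, W w (W' w x) = x) ->
  (forall w x, rnorm (W w x) <= rnorm x) ->
  (forall w x, rnorm (W' w x) <= rnorm x) ->
  (forall x, \sum_w P (W w x) = P x *+ #|Om|) ->
  \sum_w Z w = 0 ->
  rnorm (\sum_w P (W w (Z w))) ^+ 2 <=
    q ^+ k * (#|Om|%:R * \sum_w rnorm (Z w) ^+ 2).
Proof.
elim: k Om W W' Z => [|k IH] Om W W' Z WK Wle W'le Pharm Z0.
  rewrite expr0 mul1r; apply: le_trans (sqr_sum_le _).
  rewrite lerXn2r ?nnegrE ?rnorm_ge0 ?sumr_ge0// => [w _|].
    exact: rnorm_ge0.
  apply: le_trans (rnorm_sum _ _) _; apply: ler_sum => w _.
  exact: le_trans (P_contr _) (Wle _ _).
have W'iso w x : rnorm (W' w x) = rnorm x.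
  by apply/eqP; rewrite eq_le W'le/= -{1}(WK w x).
(* Two steps of the walk at once. The second increment is pulled back through [W'] of the first
   step, so that [W2] carries it to [W w.2 (Z w.2)]. *)
pose W2 (w : Om * Om) : {additive B -> B} := W w.2 \o W w.1.
pose W2' (w : Om * Om) : {additive B -> B} := W' w.1 \o W' w.2.
pose Z2 (w : Om * Om) := Z w.1 + W' w.1 (Z w.2).
have := IH _ W2 W2' Z2; rewrite card_prod.
(* Harmonicity averages out the second step acting on the first increment, so each of the two
   increments contributes the same sum, [#|Om|] times. *)
have -> : \sum_w P (W2 w (Z2 w)) =
    (#|Om|%:R : R)%:C *: (2%:C *: \sum_w P (W w (Z w))).
  have row a : \sum_b P ((W b \o W a) (Z a + W' a (Z b))) =
      P (W a (Z a)) *+ #|Om| + \sum_b P (W b (Z b)).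
    rewrite -Pharm -big_split; apply: eq_bigr => b _.
    by rewrite /= !raddfD WK.
  rewrite /W2 /Z2 -(pair_bigA _ (fun a b => P ((W b \o W a) (Z a + W' a (Z b)))))/=.
  rewrite (eq_bigr _ (fun a _ => row a)).
  rewrite big_split/= sumr_const sumrMnl.
  by rewrite !rmorph_nat !scaler_nat -mulrnDl mulr2n.
have N0 : 0 <= #|Om|%:R :> R by [].
rewrite ge0_rnorm_scale// ge0_rnorm_scale//.
set phi := rnorm _; set N : R := #|Om|%:R in N0 *.
move=> h.
have {}h : (N * (2 * phi)) ^+ 2 <=
    q ^+ k * ((#|Om| * #|Om|)%:R * \sum_w rnorm (Z2 w) ^+ 2).
  apply: h => //.
  - by move=> w x; rewrite /= WK WK.
  - by move=> w x; exact: le_trans (Wle _ _) (Wle _ _).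
  - by move=> w x; exact: le_trans (W'le _ _) (W'le _ _).
  - move=> x; rewrite /W2 -(pair_bigA _ (fun a b => P ((W b \o W a) x)))/=.
    under eq_bigr => a _ do rewrite Pharm.
    by rewrite sumrMnl Pharm mulrnA.
  rewrite /Z2 -(pair_bigA _ (fun a b => Z a + W' a (Z b)))/=.
  under eq_bigr => a _ do rewrite big_split/= -raddf_sum Z0 raddf0 addr0 sumr_const.
  by rewrite sumrMnl Z0 mul0rn.
have [Om0|Om0] := posnP #|Om|.
  rewrite /phi big1 ?rnorm0 ?expr0n/=; last by move=> w _; have := fintype0 w Om0.
  by rewrite mulr_ge0 ?exprn_ge0// mulr_ge0// sumr_ge0// => w _; exact: sqr_ge0.
have {}N0 : 0 < N by rewrite ltr0n.
have := walk_step W'iso Z0; rewrite -/Z2 -/N => step.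
have NN : 0 <= q ^+ k * (N * N) by rewrite mulr_ge0 ?exprn_ge0 ?mulr_ge0// ltW.
have {h} := le_trans h _; rewrite natrM -/N mulrA.
move=> /(_ _ (ler_wpM2l NN step)).
set S := N * \sum_w _; rewrite (_ : _ ^+ 2 = (4 * N * N) * phi ^+ 2); last by ring.
rewrite (_ : q ^+ k * (N * N) * _ = (4 * N * N) * (q ^+ k.+1 * S)); last first.
  by rewrite exprSr; ring.
by rewrite ler_pM2l// !mulr_gt0.
Qed.

(** The previous bound holds for every [k], and [q < 1]: let [k] tend to infinity. *)
Lemma harmonic_increment_eq0 (Om : finType) (W W' : Om -> {additive B -> B})
    (Z : Om -> B) :
  (forall w x, W w (W' w x) = x) ->
  (forall w x, rnorm (W w x) <= rnorm x) ->
  (forall w x, rnorm (W' w x) <= rnorm x) ->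
  (forall x, \sum_w P (W w x) = P x *+ #|Om|) ->
  \sum_w Z w = 0 -> \sum_w P (W w (Z w)) = 0.
Proof.
move=> WK Wle W'le Pharm Z0; apply: rnorm_eq0.
set a := rnorm _; set s := #|Om|%:R * \sum_w rnorm (Z w) ^+ 2.
have bnd k : a ^+ 2 <= q ^+ k * s by exact: (walk_bound k WK Wle W'le Pharm Z0).
have q1 : `|q| < 1.
  by rewrite ger0_norm// /q ltrBlDr ltrDl invr_gt0 mulr_gt0.
have a0 : a ^+ 2 <= 0.
  have lim0 : q ^+ k * s @[k --> \oo] --> (0 : R).
    by rewrite -[X in _ --> X](mul0r s); apply: cvgM; [exact: cvg_expr|exact: cvg_cst].
  rewrite -(cvg_lim (@Rhausdorff R) lim0); apply: limr_ge; first exact: cvgP lim0.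
  exact: nearW.
by apply/eqP; rewrite -sqrf_eq0 eq_le a0 sqr_ge0.
Qed.

End HarmonicWalk.

(** * Matrices of maps and decomposition of partial translations *)

Section Matrices.
Context {R : realType} {X : choiceType}.
Local Notation C := R[i].
Local Notation M := (X -> X -> C).
Implicit Types (T S V : M) (f : X -> C) (s t : X -> X).

(** Row [x] has its entry in column [s x]; with this convention matrix products reverse the order of
    composition. *)
Definition graph_mx s : M := fun x y => (y == s x)%:R.

Lemma mone_graph : mone = graph_mx id :> M.
Proof.
apply/funext => x; apply/funext => y.
by rewrite /mone /diag /graph_mx eq_sym; case: eqP.
Qed.

Lemma matrix_sumE (J : Type) (r : seq J) (F : J -> M) x y :
  (\sum_(j <- r) F j) x y = \sum_(j <- r) F j x y.
Proof. by rewrite fct_sumE fct_sumE. Qed.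

Lemma matrix_scaleE (c : C) T x y : (c *: T) x y = c * T x y.
Proof. by []. Qed.

Lemma mmul_row T S x y z : (forall y', y' != y -> T x y' = 0) ->
  mmul T S x z = T x y * S y z.
Proof.
move=> T0; rewrite /mmul -(@fsbig_widen _ _ _ _ [set y]) ?fsbig_set1//.
by move=> y' /= [_ /eqP y'y]; rewrite T0// mul0r.
Qed.

Lemma mmul_diag f T x z : mmul (diag f) T x z = f x * T x z.
Proof.
rewrite (@mmul_row _ _ _ x) /diag ?eqxx// => y /negbTE; rewrite eq_sym => ->//.
Qed.

Lemma mmul_graph s T x z : mmul (graph_mx s) T x z = T (s x) z.
Proof.
by rewrite (@mmul_row _ _ _ (s x)) /graph_mx ?eqxx ?mul1r// => y /negbTE ->.
Qed.

Lemma graph_mx_comp s t : mmul (graph_mx s) (graph_mx t) = graph_mx (t \o s).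
Proof. by apply/funext => x; apply/funext => y; rewrite mmul_graph. Qed.

Lemma mmul_sum_graph (J : finType) (c : C) (t : J -> X -> X) T :
  mmul (\sum_j c *: graph_mx (t j)) T = \sum_j c *: mmul (graph_mx (t j)) T.
Proof.
apply/funext => x; apply/funext => z; rewrite matrix_sumE.
(* In row [x] only the columns [t j x] carry entries, so the sum over all of [X] reduces to this
   finite list; repeated columns must be counted once. *)
pose r := undup [seq t j x | j <- enum J].
have tr j : t j x \in r by rewrite mem_undup map_f ?mem_enum.
rewrite /mmul -(@fsbig_widen _ _ _ _ [set` r]) ?subsetT//; last first.
  move=> y /= [_ /negP yr]; rewrite matrix_sumE big1 ?mul0r// => j _.
  rewrite !fctE /graph_mx; case: eqP => [yj|]; last by rewrite scaler0.
  by move: yr; rewrite yj tr.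
rewrite -fsbig_seq ?undup_uniq//.
under eq_bigr => y _ do rewrite matrix_sumE mulr_suml.
rewrite exchange_big /=; apply: eq_bigr => j _.
rewrite [RHS]matrix_scaleE -/(mmul (graph_mx (t j)) T x z) mmul_graph.
rewrite (bigD1_seq (t j x)) ?undup_uniq//= big1 ?addr0 => [|y /negbTE yj].
  by rewrite !fctE /graph_mx eqxx -[c *: _]/(c * _) mulr1.
by rewrite !fctE /graph_mx yj scaler0 mul0r.
Qed.

Lemma conjc_bool (b : bool) : (b%:R : C)^* = b%:R.
Proof. exact: rmorph_nat. Qed.

Lemma mstar_chiR V : mstar (chiR V) = chiR V.
Proof.
apply/funext => x; apply/funext => y; rewrite /mstar /chiR /diag eq_sym.
by case: eqP => [->|_]; [rewrite indicE conjc_bool|exact: rmorph0].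
Qed.

Lemma chiR_graph s : chiR (graph_mx s) = mone.
Proof.
rewrite /chiR /mone; congr diag; apply/funext => x.
by rewrite indicE mem_set//; exists (s x); rewrite /graph_mx eqxx.
Qed.

(** Each nonempty row of [V] is assigned to one index whose map hits its entry. The resulting sets
    [C j] are disjoint and partition the rows of [V]; the inverse maps describe the transpose. *)
Lemma graph_decomposition (J : finType) (t t' : J -> X -> X) V :
  (forall j, cancel (t j) (t' j)) -> (forall j, cancel (t' j) (t j)) ->
  (forall x y, V x y = 0 \/ V x y = 1) ->
  (forall x y z, V x y != 0 -> V x z != 0 -> y = z) ->
  (forall x y, V x y != 0 -> exists j, y = t j x) ->
  exists C : J -> set X,
    [/\ V = \sum_j mmul (diag \1_(C j)) (graph_mx (t j)),
        mstar V = \sum_j mmul (graph_mx (t' j)) (diag \1_(C j)) &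
        chiR V = \sum_j diag \1_(C j)].
Proof.
move=> tK t'K V01 Vrow Vt.
pose pk x := [pick j | V x (t j x) != 0].
pose C j := [set x | pk x = Some j].
have CE j x : (\1_(C j) x : R[i]) = (pk x == Some j)%:R.
  rewrite indicE; congr ((nat_of_bool _)%:R : R[i]); apply/idP/eqP; by rewrite inE.
have VE x y : V x y = \sum_j \1_(C j) x * (y == t j x)%:R.
  under eq_bigr => j _ do rewrite CE -natrM mulnb.
  rewrite /pk; case: pickP => [j Vj|V0] /=.
    rewrite (bigD1 j)//= big1 ?addr0 ?eqxx => [|k /negbTE kj]; last first.
      by rewrite (inj_eq Some_inj) eq_sym kj.
    have [->|yj] := eqVneq y (t j x).
      by case: (V01 x (t j x)) Vj => ->//; rewrite eqxx.
    have [//|y1] := V01 x y; move: yj; rewrite (Vrow x y (t j x)) ?eqxx//.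
    by rewrite y1 oner_eq0.
  rewrite big1//; have [->//|y1] := V01 x y.
  have [|j yj] := Vt x y; first by rewrite y1 oner_eq0.
  by have := V0 j; rewrite -yj y1 oner_eq0.
exists C; split; apply/funext => x; apply/funext => y; rewrite matrix_sumE.
- by rewrite VE; apply: eq_bigr => j _; rewrite mmul_diag.
- rewrite /mstar VE rmorph_sum /=; apply: eq_bigr => j _.
  rewrite mmul_graph /diag CE -natrM mulnb conjc_bool.
  have -> : (x == t j y) = (t' j x == y).
    by apply/eqP/eqP => [->|<-]; rewrite ?tK ?t'K.
  by have [->|_] := eqVneq (t' j x) y; rewrite ?CE ?andbT ?andbF.
rewrite /chiR /diag; case: eqP => _; last by rewrite big1.
transitivity (\sum_j V x (t j x) * \1_(C j) x); last first.
  apply: eq_bigr => j _; rewrite CE /pk.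
  case: pickP => [k Vk|] /=; last by rewrite mulr0.
  case: eqP => [[<-]|]; last by rewrite mulr0.
  by have [V0|->] := V01 x (t k x); rewrite ?mulr1//; move: Vk; rewrite V0 eqxx.
under eq_bigr => j _ do rewrite CE.
rewrite /pk indicE; case: pickP => [j Vj|V0] /=.
  rewrite (bigD1 j)//= big1 ?addr0 ?eqxx => [|k /negbTE kj]; last first.
    by rewrite (inj_eq Some_inj) eq_sym kj mulr0.
  have V1 : V x (t j x) = 1 by case: (V01 x (t j x)) Vj => ->//; rewrite eqxx.
  by rewrite V1 mulr1 mem_set//; exists (t j x).
rewrite big1 ?memNset//; last by move=> j _; rewrite mulr0.
move=> [z z1]; have [|j zj] := Vt x z; first by rewrite z1 oner_eq0.
by have := V0 j; rewrite -zj z1 oner_eq0.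
Qed.

End Matrices.

(** * Closure properties of the algebra of finite propagation matrices *)

Section RoeClosure.
Context {R : realType} {X : choiceType} (d : X -> X -> \bar R).
Local Notation C := R[i].
Local Notation M := (X -> X -> C).
Implicit Types (T S V : M) (f : X -> C) (s t : X -> X).

Definition extended_metric : Prop :=
  [/\ forall x, d x x = 0%E, forall x y, d x y = d y x &
      forall x y z, (d x z <= d x y + d y z)%E].

Definition bounded_displacement s : Prop :=
  exists r : R, forall x, (d x (s x) <= r%:E)%E.

Hypothesis dm : extended_metric.

Let d_refl x : d x x = 0%E. Proof. by case: dm. Qed.

Let d_triangle x y z (a b : R) :
  (d x y <= a%:E)%E -> (d y z <= b%:E)%E -> (d x z <= (a + b)%:E)%E.
Proof.
by case: dm => _ _ dt xy yz; rewrite (le_trans (dt x y z))// EFinD leeD.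
Qed.

Lemma bounded_displacement_id : bounded_displacement id.
Proof. by exists 0 => x; rewrite d_refl. Qed.

Lemma bounded_displacement_comp s t :
  bounded_displacement s -> bounded_displacement t ->
  bounded_displacement (t \o s).
Proof.
by move=> [a sa] [b tb]; exists (a + b) => x; exact: d_triangle (sa x) (tb (s x)).
Qed.

Lemma bounded_displacement_can s s' : cancel s' s ->
  bounded_displacement s -> bounded_displacement s'.
Proof.
move=> s'K [r sr]; exists r => x; case: dm => _ -> _.
by have := sr (s' x); rewrite s'K.
Qed.

Lemma rnorm_C1 : rnorm (1 : C) = 1.
Proof. by rewrite /rnorm normr1. Qed.

Lemma Cu_linear (c : C) T S : Cu d T -> Cu d S -> Cu d (c *: T + S).
Proof.
move=> [[K TK] [r Tr]] CS; rewrite -[S]opprK; apply: CuB; last first.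
  by rewrite -sub0r; apply: CuB CS; exact: Cu0.
split.
  exists (rnorm c * K) => x y.
  rewrite (_ : rnorm _ = rnorm c * rnorm (T x y)); last first.
    apply: (@complexI R); rewrite rmorphM /= !rnormE; exact: normrM.
  by rewrite ler_wpM2l ?rnorm_ge0.
exists r => -[x y]; rewrite /supp /= matrix_scaleE => cT.
by apply: (Tr (x, y)) => /=; apply: contra cT => /eqP ->; rewrite mulr0.
Qed.

Lemma CuZ (c : C) T : Cu d T -> Cu d (c *: T).
Proof. by move=> CT; rewrite -[_ *: _]addr0; apply: Cu_linear CT _; exact: Cu0. Qed.

Lemma CuD T S : Cu d T -> Cu d S -> Cu d (T + S).
Proof. by rewrite -[T in T + S]scale1r; exact: Cu_linear. Qed.

Lemma Cu_sum (J : Type) (r : seq J) (F : J -> M) :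
  (forall j, Cu d (F j)) -> Cu d (\sum_(j <- r) F j).
Proof. by move=> CF; elim/big_rec: _ => [|j T _ CT]; [exact: Cu0|exact: CuD]. Qed.

Lemma Cu_graph s : bounded_displacement s -> Cu d (graph_mx s).
Proof.
move=> [r sr]; split.
  by exists 1 => x y; rewrite /graph_mx; case: eqP => _; rewrite ?rnorm_C1 ?rnorm0.
exists r => -[x y]; rewrite /supp /graph_mx /=.
case: (y =P s x) => [-> _|_]; first exact: sr.
by rewrite eqxx.
Qed.

Lemma Cu_mone : Cu d mone.
Proof. by rewrite mone_graph; exact/Cu_graph/bounded_displacement_id. Qed.

Lemma Cu_mmul_graph s T : bounded_displacement s -> Cu d T ->
  Cu d (mmul (graph_mx s) T).
Proof.
move=> [a sa] [[K TK] [b Tb]]; split.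
  by exists K => x y; rewrite mmul_graph.
exists (a + b) => -[x y]; rewrite /supp /= mmul_graph => Txy.
exact: d_triangle (sa x) (Tb (s x, y) Txy).
Qed.

Lemma Cu_diag_indic (A : set X) : Cu d (diag \1_A).
Proof.
split.
  exists 1 => x y; rewrite /diag indicE; case: eqP => _; last by rewrite rnorm0.
  by case: (x \in A); rewrite ?rnorm_C1 ?rnorm0.
exists 0 => -[x y]; rewrite /supp /diag /=; case: (x =P y) => [-> _|_].
  by rewrite d_refl.
by rewrite eqxx.
Qed.

Lemma Cu_mmul_diag_indic (A : set X) T : Cu d T -> Cu d (mmul (diag \1_A) T).
Proof.
move=> [[K TK] [b Tb]]; split.
  exists K => x y; rewrite mmul_diag indicE; case: (x \in A); rewrite ?mul1r//.
  by rewrite mul0r rnorm0 (le_trans (rnorm_ge0 (T x y))).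
exists b => -[x y]; rewrite /supp /= mmul_diag => h.
by apply: (Tb (x, y)) => /=; apply: contra h => /eqP ->; rewrite mulr0.
Qed.

Lemma partial_translation_graph s : bounded_displacement s -> injective s ->
  partial_translation d (graph_mx s).
Proof.
move=> sd sI; have g0 x y : graph_mx s x y != 0 -> y = s x :> X.
  by rewrite /graph_mx; case: (y =P s x) => // _; rewrite eqxx.
split; first exact: Cu_graph.
- by move=> x y; rewrite /graph_mx; case: eqP => _; [right|left].
- by move=> x y z /g0 -> /g0 ->.
- by move=> x y z /g0 -> /g0/sI.
Qed.

Lemma partial_translation_indic (A : set X) : partial_translation d (diag \1_A).
Proof.
have g0 x y : diag (\1_A : X -> C) x y != 0 -> x = y.
  by rewrite /diag; case: (x =P y) => // _; rewrite eqxx.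
split; first exact: Cu_diag_indic.
- move=> x y; rewrite /diag indicE; case: eqP => _; last by left.
  by case: (x \in A); [right|left].
- by move=> x y z /g0 <- /g0 <-.
- by move=> x y z /g0 -> /g0 ->.
Qed.

Lemma supnorm_ge0 f : 0 <= supnorm f.
Proof.
pose E := range (fun x => rnorm (f x)); rewrite /supnorm -/E.
(* Without a supremum, as for empty [X], the default value of [sup] is 0. *)
have [Es|/sup_out ->//] := pselect (has_sup E).
have [[_ [x _ _]] _] := Es; apply: le_trans (rnorm_ge0 (f x)) _.
by apply: ub_le_sup; [exact: Es.2|exists x].
Qed.

(** The one-term decomposition with constant coefficient 1 is admissible. *)
Lemma l1norm_partial_translation V : partial_translation d V -> l1norm d V <= 1.
Proof.
move=> Vp; pose one : X -> C := fun=> 1.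
have one1 : supnorm one <= 1.
  rewrite /supnorm; have [[x]|X0] := pselect ([set: X] !=set0).
    move=> _; apply: ge_sup; first by exists (rnorm (one x)); exists x.
    by move=> _ [y _ <-]; rewrite rnorm_C1.
  rewrite (_ : range _ = set0 :> set R) ?sup0//.
  by apply/seteqP; split=> // r [y _ _]; case: X0; exists y.
apply: le_trans one1; apply: ge_inf.
  exists 0 => _ [N [f [W [_ _ _ ->]]]].
  by apply: sumr_ge0 => j _; exact: supnorm_ge0.
exists 1%N, (fun=> one), (fun=> V); split=> //.
- by move=> _; exists 1 => x; rewrite rnorm_C1.
- rewrite big_ord1; apply/funext => x; apply/funext => y.
  by rewrite mmul_diag mul1r.
by rewrite big_ord1.
Qed.

End RoeClosure.

Lemma sepdist_extended_metric (R : realType) (Xn : nat -> finType)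
    (dn : forall k, Xn k -> Xn k -> R) :
  (forall k, is_metric (dn k)) -> extended_metric (sepdist dn).
Proof.
move=> dnm.
have sameE k (x y : Xn k) : sepdist dn (existT _ k x) (existT _ k y) = (dn k x y)%:E.
  rewrite /sepdist eqxx.
  exact (congr1 (fun z => (dn k x z)%:E) (@tagged_asE _ Xn (existT _ k x) y)).
have diffE (u v : {k & Xn k}) : tag u != tag v -> sepdist dn u v = +oo%E.
  by rewrite /sepdist => /negbTE ->.
have ge0 u v : (0 <= sepdist dn u v)%E.
  rewrite /sepdist; case: eqP => // _; rewrite lee_fin.
  by case: (dnm (tag u)).
split.
- by move=> [k x]; rewrite sameE; case: (dnm k) => _ /(_ x x) [_ ->].
- move=> [k x] [l y]; have [kl|kl] := eqVneq k l.
    by subst l; rewrite !sameE; case: (dnm k) => _ _ ->.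
  by rewrite !diffE//= eq_sym.
(* Between different pieces the right-hand side is [+oo]; nonnegativity of the other summand
   excludes [-oo] there. *)
move=> u v w; have [uv|uv] := eqVneq (tag u) (tag v); last first.
  by rewrite (diffE _ _ uv) addye ?leey// gt_eqF// (lt_le_trans _ (ge0 _ _)).
have [vw|vw] := eqVneq (tag v) (tag w); last first.
  by rewrite (diffE _ _ vw) addey ?leey// gt_eqF// (lt_le_trans _ (ge0 _ _)).
move: u v w uv vw => [k x] [l y] [m z] /= kl lm; subst l m.
by rewrite !sameE -EFinD lee_fin; case: (dnm k).
Qed.

(** * Quotient norms and invariant vectors *)

Section QuotientNorm.
Context {R : realType} {B : completeNormedModType R[i]} (W : set B).
Hypothesis W0 : W 0.
Hypothesis W_linear : forall (a : R[i]) x y, W x -> W y -> W (a *: x + y).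
Implicit Types (xi eta : B).

Let W_D x y : W x -> W y -> W (x + y).
Proof. by rewrite -[x in x + y]scale1r; exact: W_linear. Qed.

Let W_Z a x : W x -> W (a *: x).
Proof. by move=> Wx; rewrite -[_ *: _]addr0; exact: W_linear. Qed.

Let quot_set xi := [set r | exists2 eta, W eta & r = rnorm (xi + eta)].

Let quot_set0 xi : quot_set xi !=set0.
Proof. by exists (rnorm (xi + 0)); exists 0. Qed.

Let quot_lbound xi : lbound (quot_set xi) 0.
Proof. by move=> _ [eta _ ->]; exact: rnorm_ge0. Qed.

Lemma quot_norm_ge0 xi : 0 <= quot_norm W xi.
Proof. by apply: lb_le_inf; [exact: quot_set0|exact: quot_lbound]. Qed.

Lemma quot_norm_le xi eta : W eta -> quot_norm W xi <= rnorm (xi + eta).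
Proof. by move=> We; apply: ge_inf; [exists 0; exact: quot_lbound|exists eta]. Qed.

Lemma quot_norm_le_norm xi : quot_norm W xi <= rnorm xi.
Proof. by rewrite -[X in rnorm X]addr0; exact: quot_norm_le. Qed.

Lemma le_quot_norm xi r : (forall eta, W eta -> r <= rnorm (xi + eta)) ->
  r <= quot_norm W xi.
Proof.
by move=> h; apply: lb_le_inf; [exact: quot_set0|move=> _ [eta We ->]; exact: h].
Qed.

Lemma quot_normD xi eta : quot_norm W (xi + eta) <= quot_norm W xi + quot_norm W eta.
Proof.
rewrite -lerBlDr; apply: le_quot_norm => u Wu; rewrite lerBlDr -lerBlDl.
apply: le_quot_norm => v Wv; rewrite lerBlDl.
apply: le_trans (rnormD _ _); rewrite addrACA; apply: quot_norm_le; exact: W_D.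
Qed.

Lemma quot_normN xi : quot_norm W (- xi) = quot_norm W xi.
Proof.
have le x : quot_norm W (- x) <= quot_norm W x.
  apply: le_quot_norm => u Wu; rewrite -rnormN opprD; apply: quot_norm_le.
  by rewrite -scaleN1r; exact: W_Z.
by apply/eqP; rewrite eq_le le/= -{1}(opprK xi) le.
Qed.

Lemma quot_normDr xi eta : W eta -> quot_norm W (xi + eta) = quot_norm W xi.
Proof.
move=> We; apply/eqP; rewrite eq_le; apply/andP; split; apply: le_quot_norm => u Wu.
  rewrite (_ : xi + u = xi + eta + (u - eta)); last by rewrite addrACA subrr addr0.
  by apply: quot_norm_le; apply: W_D => //; rewrite -scaleN1r; exact: W_Z.
by rewrite -addrA; apply: quot_norm_le; exact: W_D.
Qed.

Lemma quot_norm_scale r xi : 0 < r -> quot_norm W (r%:C *: xi) = r * quot_norm W xi.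
Proof.
move=> r0.
have le a x : 0 < a -> quot_norm W (a%:C *: x) <= a * quot_norm W x.
  move=> a0; rewrite -ler_pdivrMl//; apply: le_quot_norm => u Wu.
  rewrite ler_pdivrMl// -ge0_rnorm_scale ?(ltW a0)// scalerDr.
  by apply: quot_norm_le; exact: W_Z.
apply/eqP; rewrite eq_le le//= -ler_pdivlMl//.
have rI : 0 < r^-1 by rewrite invr_gt0.
apply: le_trans (le _ (r%:C *: xi) rI).
by rewrite scalerA -rmorphM mulVf ?gt_eqF// scale1r.
Qed.

End QuotientNorm.

(** * Operators of a single representation *)

Section Representation.
Context {R : realType} {X : choiceType} {d : X -> X -> \bar R}.
Context {B : completeNormedModType R[i]}.
Local Notation C := R[i].
Local Notation M := (X -> X -> C).
Context (pi : M -> B -> B) (pi_rep : representation d pi).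
Hypothesis dm : extended_metric d.
Implicit Types (T S V : M) (s t : X -> X) (xi eta : B).

(** [pi T] is a bare function that is linear only for [T] in [Cu d]; the bundled map gives access to
    the algebra of linear maps. *)
Definition rep_op T (CT : Cu d T) : {linear B -> B} :=
  HB.pack (pi T) (GRing.isLinear.Build _ _ _ _ _ (rep_linear pi_rep CT)).

Lemma rep_op0 T : Cu d T -> pi T 0 = 0.
Proof. by move=> CT; exact: (raddf0 (rep_op CT)). Qed.

Lemma rep_opB T xi eta : Cu d T -> pi T (xi - eta) = pi T xi - pi T eta.
Proof. by move=> CT; exact: (raddfB (rep_op CT)). Qed.

Lemma rep_opD T xi eta : Cu d T -> pi T (xi + eta) = pi T xi + pi T eta.
Proof. by move=> CT; exact: (raddfD (rep_op CT)). Qed.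

Lemma rep_opZ T (a : C) xi : Cu d T -> pi T (a *: xi) = a *: pi T xi.
Proof. by move=> CT; exact: (linearZZ (rep_op CT)). Qed.

Lemma rep0 xi : pi 0 xi = 0.
Proof.
have C0 := @Cu0 R X d.
have := @repB R unit (fun=> B) X d tt pi pi_rep 0 0 xi C0 C0.
by rewrite !subrr.
Qed.

Lemma repD T S xi : Cu d T -> Cu d S -> pi (T + S) xi = pi T xi + pi S xi.
Proof. by move=> CT CS; rewrite -{1}[T]scale1r (repP pi_rep)// scale1r. Qed.

Lemma rep_sum (J : Type) (r : seq J) (F : J -> M) xi : (forall j, Cu d (F j)) ->
  pi (\sum_(j <- r) F j) xi = \sum_(j <- r) pi (F j) xi.
Proof.
move=> CF; elim: r => [|j r IH]; first by rewrite !big_nil rep0.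
by rewrite !big_cons repD ?IH//; exact: Cu_sum.
Qed.

Lemma repZ (a : C) T xi : Cu d T -> pi (a *: T) xi = a *: pi T xi.
Proof.
move=> CT; rewrite -[a *: T]addr0 (repP pi_rep) ?rep0 ?addr0//; exact: Cu0.
Qed.

(** The bound of representations by the l1 norm enters the argument here. *)
Lemma rep_contraction V xi : partial_translation d V ->
  rnorm (pi V xi) <= rnorm xi.
Proof.
move=> Vp; have [CV _ _ _] := Vp.
apply: le_trans (@opnormP R unit (fun=> B) X d tt pi pi_rep V xi CV) _.
rewrite ler_piMl ?rnorm_ge0// (le_trans (rep_bound pi_rep CV))//.
exact: l1norm_partial_translation.
Qed.

Lemma rep_graph_comp s t xi : bounded_displacement d s -> bounded_displacement d t ->
  pi (graph_mx (t \o s)) xi = pi (graph_mx s) (pi (graph_mx t) xi).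
Proof.
by move=> sd td; rewrite -graph_mx_comp (repM pi_rep)//; exact: Cu_graph.
Qed.

Lemma rep_graph_id xi : pi (graph_mx id) xi = xi.
Proof. by rewrite -mone_graph (rep1 pi_rep). Qed.

Lemma invariants0 : invariants d pi 0.
Proof.
move=> V [CV _ _ _]; have CC : Cu d (chiR V) by exact: Cu_diag_indic.
by rewrite !rep_op0.
Qed.

Lemma invariants_linear (a : C) xi eta : invariants d pi xi ->
  invariants d pi eta -> invariants d pi (a *: xi + eta).
Proof.
move=> xii etai V Vp; have [CV _ _ _] := Vp.
have CC : Cu d (chiR V) by exact: Cu_diag_indic.
by rewrite !rep_opD ?rep_opZ// xii// etai.
Qed.

End Representation.

(** * Words in the generators and tests for invariance *)

Section Words.
Context {R : realType} {X : choiceType} {d : X -> X -> \bar R}.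
Hypothesis dm : extended_metric d.
Context {n : nat} (s s' : 'I_n -> X -> X).
Hypothesis sK : forall i, cancel (s i) (s' i).
Hypothesis s'K : forall i, cancel (s' i) (s i).
Hypothesis s_bounded : forall i, bounded_displacement d (s i).
Implicit Types (w : seq 'I_n).

(** The first letter acts first; [word_inv] undoes the letters from the last one backwards. *)
Fixpoint word w : X -> X := if w is i :: v then word v \o s i else id.
Fixpoint word_inv w : X -> X := if w is i :: v then s' i \o word_inv v else id.

Lemma word_rcons w i x : word (rcons w i) x = s i (word w x).
Proof. by elim: w x => //= j w IH x. Qed.

Lemma wordK w : cancel (word w) (word_inv w).
Proof. by elim: w => //= i w IH x /=; rewrite IH sK. Qed.

Lemma word_invK w : cancel (word_inv w) (word w).
Proof. by elim: w => //= i w IH x /=; rewrite s'K IH. Qed.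

Lemma inv_bounded i : bounded_displacement d (s' i).
Proof. exact: bounded_displacement_can (s'K i) (s_bounded i). Qed.

Lemma word_bounded w : bounded_displacement d (word w).
Proof.
elim: w => /= [|i w IH]; first exact: bounded_displacement_id.
exact: bounded_displacement_comp.
Qed.

Lemma word_inv_bounded w : bounded_displacement d (word_inv w).
Proof. exact: bounded_displacement_can (@word_invK w) (word_bounded w). Qed.

Variable E0 : set (X * X).
Hypothesis E0_graphs : forall x y, E0 (x, y) -> exists i, y = s i x.
Hypothesis E0_gen : generating d E0.

Lemma ncomp_word m x y : ncomp E0 m (x, y) -> exists w : m.-tuple 'I_n, y = word w x.
Proof.
elim: m x y => [|m IH] x y /=.
  by move=> [z _ [<- <-]]; exists [tuple].
move=> [z xz zy]; have [i yE] := E0_graphs zy; have [w zE] := IH _ _ xz.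
by exists [tuple of rcons w i]; rewrite word_rcons yE zE.
Qed.

(** The support of [V] lies in some [m]-fold composition of [E0], and there are only finitely many
    words of length [m]. *)
Lemma partial_translation_words V : partial_translation d V ->
  exists (J : finType) (w : J -> seq 'I_n), forall x y,
    V x y != 0 -> exists j, y = word (w j) x.
Proof.
move=> [[_ Vent] _ _ _]; have [m m0 Vm] := E0_gen.2 _ Vent.
exists (m.-tuple 'I_n), (fun w : m.-tuple 'I_n => tval w) => x y Vxy.
exact: ncomp_word (Vm (x, y) Vxy).
Qed.

Section Invariants.
Context {B : completeNormedModType R[i]} (pi : (X -> X -> R[i]) -> B -> B).
Hypothesis pi_rep : representation d pi.

Lemma rep_can i xi : pi (graph_mx (s i)) (pi (graph_mx (s' i)) xi) = xi.
Proof.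
rewrite -(rep_graph_comp pi_rep)//; last exact: inv_bounded.
rewrite (_ : _ \o _ = id) ?(rep_graph_id pi_rep)//.
by apply/funext => x /=; exact: sK.
Qed.

Lemma rep_inv_can i xi : pi (graph_mx (s' i)) (pi (graph_mx (s i)) xi) = xi.
Proof.
rewrite -(rep_graph_comp pi_rep)//; last exact: inv_bounded.
rewrite (_ : _ \o _ = id) ?(rep_graph_id pi_rep)//.
by apply/funext => x /=; exact: s'K.
Qed.

(** A vector fixed by the generators is fixed by all words, and [V] is a finite sum of words cut off
    by indicators whose sum is [chiR V]. *)
Lemma invariantsP xi :
  invariants d pi xi <-> forall i, pi (graph_mx (s i)) xi = xi.
Proof.
split=> [xii i|fix_s].
  have sp : partial_translation d (graph_mx (s i)).
    exact: partial_translation_graph (s_bounded i) (can_inj (sK i)).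
  by rewrite xii// chiR_graph (rep1 pi_rep).
have fix_w w : pi (graph_mx (word w)) xi = xi.
  elim: w => [|i w IH] /=; first exact: (rep_graph_id pi_rep).
  by rewrite (rep_graph_comp pi_rep)// ?IH//; exact: word_bounded.
move=> V Vp; have [J [w Vw]] := partial_translation_words Vp.
have [_ V01 Vrow _] := Vp.
have [D [-> _ ->]] := graph_decomposition
  (fun j => @wordK (w j)) (fun j => @word_invK (w j)) V01 Vrow Vw.
have Cw j : Cu d (graph_mx (word (w j))) by exact/Cu_graph/word_bounded.
have CD j : Cu d (diag (\1_(D j) : X -> R[i])) by exact: Cu_diag_indic.
rewrite !(rep_sum pi_rep)//; last by move=> j; exact: Cu_mmul_diag_indic.
by apply: eq_bigr => j _; rewrite (repM pi_rep)// fix_w.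
Qed.

(** The dual action involves [mstar V], where each word becomes its inverse, followed in the product
    by the indicator; hence the test on [s']. *)
Lemma dual_invariants_fixed (f : B -> R[i]^o) : dual_space f ->
  (forall i xi, f (pi (graph_mx (s' i)) xi) = f xi) -> dual_invariants d pi f.
Proof.
move=> fd fix_f; split=> // V Vp.
have [f_lin _] := fd.
pose fl : {linear B -> R[i]^o} := HB.pack f (GRing.isLinear.Build _ _ _ _ _ f_lin).
have fix_w w xi : f (pi (graph_mx (word_inv w)) xi) = f xi.
  elim: w xi => [|i w IH] xi /=; first by rewrite (rep_graph_id pi_rep).
  rewrite (rep_graph_comp pi_rep) ?IH//; first exact: word_inv_bounded.
  exact: inv_bounded.
have [J [w Vw]] := partial_translation_words Vp.
have [_ V01 Vrow _] := Vp.
have [D [_ VE chiE]] := graph_decomposition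
  (fun j => @wordK (w j)) (fun j => @word_invK (w j)) V01 Vrow Vw.
apply/funext => xi; rewrite /dual_rep mstar_chiR VE chiE.
have Cw j : Cu d (graph_mx (word_inv (w j))) by exact/Cu_graph/word_inv_bounded.
have CD j : Cu d (diag (\1_(D j) : X -> R[i])) by exact: Cu_diag_indic.
rewrite !(rep_sum pi_rep)//; last first.
  by move=> j; apply: Cu_mmul_graph (CD j) => //; exact: word_inv_bounded.
have f_sum (F : J -> B) : f (\sum_j F j) = \sum_j f (F j).
  exact: (raddf_sum fl).
rewrite !f_sum; apply: eq_bigr => j _.
by rewrite (repM pi_rep)// fix_w.
Qed.

Lemma dual_invariantsP f i xi : dual_invariants d pi f ->
  f (pi (graph_mx (s i)) xi) = f xi.
Proof.
move=> [_ fi].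
have sp : partial_translation d (graph_mx (s' i)).
  exact: partial_translation_graph (inv_bounded i) (can_inj (s'K i)).
have := congr1 (fun g => g xi) (fi _ sp); rewrite /dual_rep mstar_chiR.
have -> : mstar (graph_mx (s' i)) = graph_mx (s i) :> (X -> X -> R[i]).
  apply/funext => x; apply/funext => y; rewrite /mstar /graph_mx conjc_bool.
  congr (_%:R); congr nat_of_bool.
  by apply/eqP/eqP => ->; rewrite ?sK ?s'K.
by move=> ->; rewrite chiR_graph (rep1 pi_rep).
Qed.

End Invariants.
End Words.

(** * Limits *)

Section ComplexLimits.
Context {R : realType} {B : completeNormedModType R[i]}.
Implicit Types (u v : nat -> B) (l : B).

Lemma rnorm_distD (x y : B) : `|rnorm x - rnorm y| <= rnorm (x - y).
Proof.
rewrite ler_norml; apply/andP; split.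
  by have := rnormD (y - x) x; rewrite subrK rnorm_distC; lra.
by have := rnormD (x - y) y; rewrite subrK; lra.
Qed.

(** Passes from the topology given by the norm with values in [R[i]] to real sequences. *)
Lemma rcvgP u l : u @ \oo --> l <->
  (fun k => rnorm (u k - l)) @ \oo --> (0 : R).
Proof.
have absE k : `|0 - rnorm (u k - l)| = rnorm (u k - l).
  by rewrite sub0r normrN ger0_norm ?rnorm_ge0.
split=> [/cvgrPdist_le ul|/cvgrPdist_le ul]; apply/cvgrPdist_le => e e0.
  have e0' : 0 < e%:C :> R[i] by rewrite ltcR.
  have := ul _ e0'; apply: filterS => k.
  by rewrite absE -rnormE lecR rnorm_distC.
have eE : (complex.Re e)%:C = e by rewrite RRe_real // gtr0_real.
have e0' : 0 < complex.Re e by rewrite -ltcR eE.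
have := ul _ e0'; apply: filterS => k.
by rewrite absE -rnormE -eE lecR rnorm_distC.
Qed.

Lemma cvg_rnorm u l : u @ \oo --> l -> rnorm (u k) @[k --> \oo] --> rnorm l.
Proof.
move=> /rcvgP/cvgrPdist_le ul; apply/cvgrPdist_le => e /ul; apply: filterS => k.
rewrite sub0r normrN ger0_norm ?rnorm_ge0// => h.
by rewrite distrC (le_trans (rnorm_distD _ _)).
Qed.

Lemma rcauchy_cvg u :
  (forall e : R, 0 < e -> exists N, forall k, (N <= k)%N -> rnorm (u k - u N) < e) ->
  cvgn u.
Proof.
move=> uc; apply/cauchy_cvgP/cauchy_exP => e e0.
have eE : (complex.Re e)%:C = e by rewrite RRe_real // gtr0_real.
have e0' : 0 < complex.Re e by rewrite -ltcR eE.
have [N uN] := uc _ e0'; exists (u N); exists N => // k /= Nk.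
by rewrite -ball_normE /= -rnormE -eE ltcR rnorm_distC uN.
Qed.

Lemma rcvg_uniq u (l l' : B) : u @ \oo --> l -> u @ \oo --> l' -> l = l'.
Proof. by move=> ul ul'; apply: cvg_unique ul ul'; exact: norm_hausdorff. Qed.

Lemma rcvg_le u l (r : R) : u @ \oo --> l -> (forall k, rnorm (u k) <= r) ->
  rnorm l <= r.
Proof.
move=> ul ur; have rl := cvg_rnorm ul.
rewrite -(cvg_lim (@Rhausdorff R) rl); apply: limr_le; first exact: cvgP rl.
exact: nearW.
Qed.

Lemma continuous_cvg_seq (f : B -> B) u l : continuous f -> u @ \oo --> l ->
  f (u k) @[k --> \oo] --> f l.
Proof. by move=> fc ul; apply: continuous_cvg => //; exact: fc. Qed.

End ComplexLimits.

Section GeometricRate.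
Context {R : realType} (rho : R).
Hypothesis rho01 : 0 < rho < 1.

Let rho1 : 0 < 1 - rho. Proof. by move: rho01 => /andP[_]; rewrite subr_gt0. Qed.

Lemma geometric_increment (B : normedModType R[i]) (u : nat -> B) (D : R) :
  (forall k, rnorm (u k.+1 - u k) <= D * rho ^+ k) ->
  forall k l, (k <= l)%N -> rnorm (u l - u k) <= D * rho ^+ k / (1 - rho).
Proof.
move=> uD k l /subnKC <-; have D0 : 0 <= D.
  by have := uD 0; rewrite expr0 mulr1; apply: le_trans; exact: rnorm_ge0.
have [r0 r1] := andP rho01.
have a0 : 0 <= D * rho ^+ k by rewrite mulr_ge0// exprn_ge0// ltW.
rewrite ler_pdivlMr//.
(* The exact partial sum of the geometric series is what makes the induction close. *)
suff h m : rnorm (u (k + m)%N - u k) * (1 - rho) <= D * rho ^+ k * (1 - rho ^+ m).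
  apply: le_trans (h _) _; rewrite ler_piMr// lerBlDr lerDl exprn_ge0// ltW//.
elim: m => [|m IH]; first by rewrite addn0 subrr rnorm0 mul0r expr0 subrr mulr0.
have := uD (k + m)%N; rewrite addnS => h.
have := rnormD (u (k + m).+1 - u (k + m)%N) (u (k + m)%N - u k).
rewrite addrA subrK => h2.
have h3 : rnorm (u (k + m).+1 - u k) * (1 - rho) <=
    (D * rho ^+ (k + m) + rnorm (u (k + m)%N - u k)) * (1 - rho).
  by rewrite ler_pM2r// (le_trans h2)// lerD2r.
apply: (le_trans h3); rewrite mulrDl exprD.
apply: le_trans (lerD (lexx _) IH) _.
by rewrite exprS le_eqVlt; apply/orP; left; apply/eqP; ring.
Qed.

Lemma geometric_small (D : R) (e : R) : 0 < e ->
  exists N, forall k, (N <= k)%N -> D * rho ^+ k / (1 - rho) < e.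
Proof.
move=> e0; have r1 : `|rho| < 1 by have [r0 ?] := andP rho01; rewrite gtr0_norm.
have : D / (1 - rho) * rho ^+ k @[k --> \oo] --> (0 : R).
  rewrite -[X in _ --> X](mulr0 (D / (1 - rho))).
  by apply: cvgM; [exact: cvg_cst|exact: cvg_expr].
move=> /cvgrPdist_lt/(_ _ e0) [N _ h]; exists N => k Nk.
have := h k Nk; rewrite /= sub0r normrN mulrAC; exact: le_lt_trans (ler_norm _).
Qed.

End GeometricRate.

(** * The averaging operator *)

Section Averaging.
Context {R : realType} {X : choiceType} {d : X -> X -> \bar R}.
Hypothesis dm : extended_metric d.
Context {n : nat} (s s' : 'I_n -> X -> X).
Hypothesis n_gt0 : (0 < n)%N.
Hypothesis sK : forall i, cancel (s i) (s' i).
Hypothesis s'K : forall i, cancel (s' i) (s i).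
Hypothesis s_bounded : forall i, bounded_displacement d (s i).
Variable E0 : set (X * X).
Hypothesis E0_graphs : forall x y, E0 (x, y) -> exists i, y = s i x.
Hypothesis E0_gen : generating d E0.
Local Notation C := R[i].
Local Notation M := (X -> X -> C).

Definition avg : M := averaging (fun i => graph_mx (s i)).

(* In averaging A each step of the walk is lazy: the boolean tells whether the
   generator is applied. *)
Definition lazy_step (T : Type) (f : 'I_n -> T) (e : T) (j : 'I_n * bool) : T :=
  if j.2 then f j.1 else e.

Lemma avg_lazyE :
  avg = \sum_j (n%:R^-1 * 2^-1 : C) *: graph_mx (lazy_step s id j).
Proof.
rewrite /avg /averaging scaler_sumr.
rewrite -(pair_bigA _ (fun i b =>
  (n%:R^-1 * 2^-1) *: graph_mx (lazy_step s id (i, b))))/=.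
apply: eq_bigr => i _; rewrite big_bool /= /lazy_step /= -mone_graph.
by rewrite scalerA -scalerDr addrC.
Qed.

Lemma lazy_bounded j : bounded_displacement d (lazy_step s id j).
Proof.
by rewrite /lazy_step; case: j.2 => //; exact: bounded_displacement_id.
Qed.

Lemma Cu_mmul_avg T : Cu d T -> Cu d (mmul avg T).
Proof.
move=> CT; rewrite avg_lazyE mmul_sum_graph; apply: Cu_sum => j; apply: CuZ.
by apply: Cu_mmul_graph CT => //; exact: lazy_bounded.
Qed.

Lemma Cu_avg : Cu d avg.
Proof.
rewrite avg_lazyE; apply: Cu_sum => j; apply/CuZ/Cu_graph; exact: lazy_bounded.
Qed.

Lemma Cu_mpow_avg k : Cu d (mpow avg k).
Proof.
by elim: k => [|k IH]; [exact: Cu_mone|exact: Cu_mmul_avg].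
Qed.

Let n0 : 0 < n%:R :> R. Proof. by rewrite ltr0n. Qed.

Section OneRepresentation.
Context {B : completeNormedModType C} (pi : M -> B -> B).
Hypothesis pi_rep : representation d pi.
Implicit Types (xi eta zeta : B).
Local Notation W := (invariants d pi).
Local Notation A i := (pi (graph_mx (s i))).

Let CA i : Cu d (graph_mx (s i)). Proof. exact: Cu_graph. Qed.

Let sp i : partial_translation d (graph_mx (s i)).
Proof. exact: partial_translation_graph (s_bounded i) (can_inj (sK i)). Qed.

Let s'p i : partial_translation d (graph_mx (s' i)).
Proof.
exact: partial_translation_graph (inv_bounded dm s'K s_bounded i) (can_inj (s'K i)).
Qed.

(** Cleared of denominators, so that additivity and the real-valued norm suffice later. *)
Lemma avg_repE xi : pi avg xi *+ (n * 2) = \sum_i (xi + A i xi).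
Proof.
rewrite /avg /averaging (repZ pi_rep); last first.
  by apply: Cu_sum => i; apply: CuZ; apply: CuD => //; exact: Cu_mone.
rewrite (rep_sum pi_rep); last first.
  by move=> i; apply: CuZ; apply: CuD => //; exact: Cu_mone.
rewrite -scaler_nat scalerA natrM mulrAC mulfV ?mul1r; last by rewrite pnatr_eq0 -lt0n.
rewrite scaler_sumr; apply: eq_bigr => i _.
rewrite (repZ pi_rep) ?scalerA ?mulfV ?scale1r ?pnatr_eq0//; last first.
  by apply: CuD => //; exact: Cu_mone.
by rewrite (repD pi_rep) ?(rep1 pi_rep)//; exact: Cu_mone.
Qed.

Lemma rep_graph_isometry i xi : rnorm (A i xi) = rnorm xi.
Proof.
apply/eqP; rewrite eq_le (rep_contraction pi_rep)//=.
rewrite -{1}(rep_inv_can dm s'K s_bounded pi_rep i xi).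
exact: (rep_contraction pi_rep _ (s'p i)).
Qed.

Lemma rnormMn xi k : rnorm (xi *+ k) = k%:R * rnorm xi.
Proof. by rewrite -scaler_nat -(rmorph_nat (real_complex R)) ge0_rnorm_scale. Qed.

Lemma avg_contraction xi : rnorm (pi avg xi) <= rnorm xi.
Proof.
have n20 : 0 < (n * 2)%:R :> R by rewrite natrM mulr_gt0.
rewrite -(ler_pM2l n20) -rnormMn avg_repE; apply: le_trans (rnorm_sum _ _) _.
rewrite natrM -mulrA -[n in n%:R](card_ord n) -sumr_const_natl.
apply: ler_sum => i _.
by apply: le_trans (rnormD _ _) _; rewrite rep_graph_isometry; lra.
Qed.

Let W0 : W 0. Proof. exact: invariants0. Qed.

Let W_lin (a : C) xi eta : W xi -> W eta -> W (a *: xi + eta).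
Proof. exact: invariants_linear. Qed.

Lemma invariants_step xi i : W xi -> A i xi = xi.
Proof. by move=> /(invariantsP dm sK s'K s_bounded E0_graphs E0_gen pi_rep). Qed.

Lemma avg_invariant xi : W xi -> pi avg xi = xi.
Proof.
move=> Wxi; have avgE : (pi avg xi - xi) *+ (n * 2) = 0.
  rewrite mulrnBl avg_repE; under eq_bigr do rewrite invariants_step//.
  by rewrite sumr_const card_ord -mulr2n -mulrnA mulnC subrr.
apply/eqP; rewrite -subr_eq0; apply/eqP/rnorm_eq0/eqP.
have := rnormMn (pi avg xi - xi) (n * 2); rewrite avgE rnorm0 => /esym/eqP.
by rewrite mulf_eq0 pnatr_eq0 muln_eq0 eqn0Ngt n_gt0.
Qed.

Lemma mpow_invariant k xi : W xi -> pi (mpow avg k) xi = xi.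
Proof.
move=> Wxi; elim: k => [|k IH]; first exact: (rep1 pi_rep).
by rewrite (repM pi_rep) ?IH ?avg_invariant//; [exact: Cu_avg|exact: Cu_mpow_avg].
Qed.

Lemma rep_mpowS k xi : pi (mpow avg k.+1) xi = pi avg (pi (mpow avg k) xi).
Proof. by rewrite (repM pi_rep)//; [exact: Cu_avg|exact: Cu_mpow_avg]. Qed.

Lemma rep_mpowSr k xi : pi (mpow avg k.+1) xi = pi (mpow avg k) (pi avg xi).
Proof.
elim: k => [|k IH]; first by rewrite rep_mpowS !(rep1 pi_rep).
by rewrite rep_mpowS IH -rep_mpowS.
Qed.

(** Since [T] fixes the invariant vectors, the displacement depends only on the class of [xi], and
    any representative bounds it by twice its norm. *)
Lemma displacement_le T xi : Cu d T ->
  (forall zeta, rnorm (pi T zeta) <= rnorm zeta) ->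
  (forall eta, W eta -> pi T eta = eta) ->
  rnorm (pi T xi - xi) <= 2 * quot_norm W xi.
Proof.
move=> CT Tc TW; rewrite -ler_pdivrMl//; apply: le_quot_norm => // eta We.
rewrite ler_pdivrMl//.
have -> : pi T xi - xi = pi T (xi + eta) - (xi + eta).
  by rewrite (rep_opD pi_rep)// (TW eta)// opprD addrACA subrr addr0.
by apply: le_trans (rnormB _ _) _; have := Tc (xi + eta); lra.
Qed.

Section Gap.
Variables (c e : R).
Hypothesis c_gt0 : 0 < c.
Hypothesis gap : spectral_gap_gt d E0 pi c.
Hypothesis e01 : 0 < e < 1.
Hypothesis ball_e : forall u v : B, rnorm v = rnorm u ->
  c / (2 * n%:R) * rnorm u <= rnorm (u - v) -> rnorm (u + v) <= 2 * (1 - e) * rnorm u.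

(** For a unit class the gap provides [V], which decomposes into generators cut off by indicators.
    Its displacement is at most the sum of those of the [n] generators, one of which must carry an
    [n]-th part. *)
Lemma gap_displacement xi :
  exists i, c * quot_norm W xi <= n%:R * rnorm (A i xi - xi).
Proof.
set q := quot_norm W xi.
have [q0|q0] := eqVneq q 0.
  by exists (Ordinal n_gt0); rewrite q0 mulr0 mulr_ge0 ?rnorm_ge0.
have {}q0 : 0 < q by rewrite lt_neqAle eq_sym q0 quot_norm_ge0.
have qI : 0 < q^-1 by rewrite invr_gt0.
pose z := (q^-1)%:C *: xi.
have z1 : quot_norm W z = 1 by rewrite quot_norm_scale// mulVf// gt_eqF.
have [c' cc' /(_ z z1) [V [Vp VE0 c'V]]] := gap.
have [CV V01 Vrow _] := Vp.
have Vs x y : V x y != 0 -> exists i, y = s i x.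
  by move=> Vxy; apply: E0_graphs; exact: (VE0 (x, y)).
have [D [VE _ chiE]] := graph_decomposition sK s'K V01 Vrow Vs.
have CD i : Cu d (diag (\1_(D i) : X -> C)) by exact: Cu_diag_indic.
have : c < \sum_i rnorm (A i z - z).
  apply: (lt_le_trans cc'); apply: (le_trans c'V).
  apply: le_trans (quot_norm_le_norm W0 _) _.
  rewrite chiE VE !(rep_sum pi_rep)//; last by move=> j; exact: Cu_mmul_diag_indic.
  rewrite -sumrB; apply: le_trans (rnorm_sum _ _) _; apply: ler_sum => i _.
  rewrite (repM pi_rep)// -(rep_opB pi_rep)//.
  by apply: (rep_contraction pi_rep); exact: partial_translation_indic.
have zE i : rnorm (A i z - z) = q^-1 * rnorm (A i xi - xi).
  by rewrite /z (rep_opZ pi_rep)// -scalerBr ge0_rnorm_scale// ltW.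
under eq_bigr do rewrite zE.
rewrite -mulr_sumr mulrC ltr_pdivlMr// => h.
apply/not_existsP => small; suff : c * q < c * q by rewrite ltxx.
apply: (lt_le_trans h); rewrite -(ler_pM2l n0) mulr_sumr.
rewrite -[n in X in _ <= X](card_ord n) -sumr_const_natl.
by apply: ler_sum => i _; apply/ltW; rewrite ltNge; apply/negP; exact: small.
Qed.

(** One generator out of [n] yields the ratio [1 - e / n]; halving the saving also ensures
    [rho >= 1/2], needed for long representatives. *)
Let rho := 1 - e / (2 * n%:R).

Lemma gap_rate_bounds : 2^-1 <= rho /\ 0 < rho < 1.
Proof.
have [e0 e1] := andP e01.
have n1 : 1 <= n%:R :> R by rewrite ler1n.
have h : e / (2 * n%:R) <= 2^-1.
  by rewrite ler_pdivrMr ?mulr_gt0//; lra.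
have h' : 0 < e / (2 * n%:R) by rewrite divr_gt0// mulr_gt0.
by rewrite /rho; split; [lra|apply/andP; split; lra].
Qed.

Lemma gap_contraction xi : quot_norm W (pi avg xi) <= rho * quot_norm W xi.
Proof.
have [rho2 /andP[rho0 rho1]] := gap_rate_bounds; have [e0 e1] := andP e01.
set q := quot_norm W xi.
have avgW eta : W eta -> quot_norm W (pi avg xi) = quot_norm W (pi avg (xi + eta)).
  move=> We; rewrite (rep_opD pi_rep); last exact: Cu_avg.
  by rewrite (avg_invariant We) quot_normDr.
have le_q : quot_norm W (pi avg xi) <= q.
  apply: le_quot_norm => // eta We; rewrite (avgW eta We).
  exact: le_trans (quot_norm_le_norm W0 _) (avg_contraction _).
rewrite -ler_pdivrMl//; apply: le_quot_norm => // eta We; rewrite ler_pdivrMl//.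
have r0 := rnorm_ge0 (xi + eta).
(* If the representative has norm at least [2 q], then [q] is at most [rho] times that norm.
   Otherwise the displacement, at least [c q / n], reaches the threshold of [ball_e]. *)
have [U2q|/ltW U2q] := leP (rnorm (xi + eta)) (2 * q); last first.
  have : 2^-1 * rnorm (xi + eta) <= rho * rnorm (xi + eta) by rewrite ler_wpM2r.
  lra.
rewrite (avgW eta We); apply: le_trans (quot_norm_le_norm W0 _) _.
set U := xi + eta in r0 U2q *.
have [i0 i0q] := gap_displacement xi; rewrite -/q in i0q.
have dU : A i0 xi - xi = A i0 U - U.
  by rewrite /U (rep_opD pi_rep)// (invariants_step i0 We) opprD addrACA subrr addr0.
have i0U : rnorm (U + A i0 U) <= 2 * (1 - e) * rnorm U.
  apply: ball_e; first exact: rep_graph_isometry.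
  rewrite rnorm_distC -dU invfM mulrA mulrAC ler_pdivrMr// [X in _ <= X]mulrC.
  apply: le_trans i0q; rewrite mulrAC.
  have : c * rnorm U <= c * (2 * q) by rewrite ler_wpM2l// ltW.
  lra.
have n20 : 0 < (n * 2)%:R :> R by rewrite natrM mulr_gt0.
rewrite -(ler_pM2l n20) -rnormMn avg_repE; apply: le_trans (rnorm_sum _ _) _.
have le2 i : rnorm (U + A i U) <= 2 * rnorm U.
  by apply: le_trans (rnormD _ _) _; rewrite rep_graph_isometry; lra.
apply: (@le_trans _ _ (\sum_i (2 * rnorm U - (i == i0)%:R * (2 * e * rnorm U)))).
  apply: ler_sum => i _; have [->|_] := eqVneq i i0; last by rewrite mul0r subr0.
  by rewrite mul1r; lra.
rewrite sumrB sumr_const_natl card_ord -mulr_suml (bigD1 i0)//=.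
rewrite big1 ?addr0 ?eqxx ?mul1r.
  rewrite natrM (_ : n%:R * 2 * (rho * rnorm U) = n%:R * (2 * rnorm U) - e * rnorm U).
    have : 0 <= e * rnorm U by rewrite mulr_ge0// ltW.
    by lra.
  by rewrite /rho; field; rewrite gt_eqF.
by move=> i /negbTE ->.
Qed.

Lemma gap_contraction_iter k xi :
  quot_norm W (pi (mpow avg k) xi) <= rho ^+ k * rnorm xi.
Proof.
have [_ /andP[rho0 _]] := gap_rate_bounds.
elim: k => [|k IH]; first by rewrite expr0 mul1r (rep1 pi_rep) quot_norm_le_norm.
rewrite rep_mpowS; apply: le_trans (gap_contraction _) _.
by rewrite exprS -mulrA ler_pM2l.
Qed.

(** The increment is the displacement of the [k]-th iterate by [avg], hence at most twice the
    quotient norm of that iterate. *)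
Lemma gap_increment k xi :
  rnorm (pi (mpow avg k.+1) xi - pi (mpow avg k) xi) <= 2 * rnorm xi * rho ^+ k.
Proof.
rewrite rep_mpowS; apply: le_trans (displacement_le _ _ _ _) _.
- exact: Cu_avg.
- exact: avg_contraction.
- by move=> eta; exact: avg_invariant.
by rewrite -mulrA ler_pM2l// mulrC gap_contraction_iter.
Qed.

End Gap.
End OneRepresentation.
End Averaging.

(** * The limit of the powers as projection onto the invariant vectors *)

Section AveragingLimit.
Context {R : realType} {X : choiceType} {d : X -> X -> \bar R}.
Hypothesis dm : extended_metric d.
Context {n : nat} (s s' : 'I_n -> X -> X).
Hypothesis n_gt0 : (0 < n)%N.
Hypothesis sK : forall i, cancel (s i) (s' i).
Hypothesis s'K : forall i, cancel (s' i) (s i).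
Hypothesis s_bounded : forall i, bounded_displacement d (s i).
Variable E0 : set (X * X).
Hypothesis E0_graphs : forall x y, E0 (x, y) -> exists i, y = s i x.
Hypothesis E0_gen : generating d E0.
Local Notation C := R[i].
Local Notation M := (X -> X -> C).
Context {B : completeNormedModType C} (pi : M -> B -> B).
Hypothesis pi_rep : representation d pi.
Implicit Types (xi eta zeta : B).
Local Notation W := (invariants d pi).
Local Notation A i := (pi (graph_mx (s i))).
Local Notation A' i := (pi (graph_mx (s' i))).
Local Notation avg_pow k := (pi (mpow (avg s) k)).

Variables (rho K : R).
Hypothesis rho01 : 0 < rho < 1.
Hypothesis contraction_rate : forall k xi,
  quot_norm W (avg_pow k xi) <= rho ^+ k * rnorm xi.
Hypothesis increment_rate : forall k xi,
  rnorm (avg_pow k.+1 xi - avg_pow k xi) <= 2 * rnorm xi * rho ^+ k.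
Hypothesis K1 : 1 <= K.
Hypothesis parallelogram : forall u v : B,
  rnorm (u - v) ^+ 2 <= 4^-1 * (rnorm u ^+ 2 + rnorm v ^+ 2) +
    K * (2 * rnorm u ^+ 2 + 2 * rnorm v ^+ 2 - rnorm (u + v) ^+ 2).

Let CA i : Cu d (graph_mx (s i)). Proof. exact: Cu_graph. Qed.

Let CA' i : Cu d (graph_mx (s' i)).
Proof. exact/Cu_graph/(inv_bounded dm s'K s_bounded). Qed.

Let Cpow k : Cu d (mpow (avg s) k). Proof. exact: Cu_mpow_avg. Qed.

Definition avg_lim xi : B := limn (fun k => avg_pow k xi).

Lemma avg_lim_cvg xi : avg_pow k xi @[k --> \oo] --> avg_lim xi.
Proof.
apply: (rcauchy_cvg (u := fun k => avg_pow k xi)) => r r0.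
have [N hN] := geometric_small rho01 (2 * rnorm xi) r0.
exists N => k Nk; apply: le_lt_trans (hN N (leqnn N)).
by apply: (geometric_increment rho01 (u := fun k => avg_pow k xi)).
Qed.

Lemma avg_lim_linear : linear avg_lim.
Proof.
move=> a xi eta; apply: (rcvg_uniq (@avg_lim_cvg _)).
rewrite (_ : (fun k => _) = fun k => a *: avg_pow k xi + avg_pow k eta).
  by apply: cvgD (@avg_lim_cvg eta); apply: cvgZr => //; exact: avg_lim_cvg.
by apply/funext => k; rewrite (rep_opD pi_rep)// (rep_opZ pi_rep).
Qed.

Definition avg_lim_op : {linear B -> B} :=
  HB.pack avg_lim (GRing.isLinear.Build _ _ _ _ _ avg_lim_linear).

Lemma mpow_contraction k xi : rnorm (avg_pow k xi) <= rnorm xi.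
Proof.
elim: k => [|k IH]; first by rewrite (rep1 pi_rep).
rewrite (rep_mpowS dm s_bounded pi_rep) (le_trans _ IH)//.
exact: (avg_contraction dm n_gt0 sK s'K s_bounded pi_rep).
Qed.

Lemma avg_lim_contraction xi : rnorm (avg_lim xi) <= rnorm xi.
Proof. by apply: (rcvg_le (@avg_lim_cvg xi)) => k; exact: mpow_contraction. Qed.

Lemma avg_lim_invariant xi : W xi -> avg_lim xi = xi.
Proof.
move=> Wxi; apply: (rcvg_uniq (@avg_lim_cvg _)).
rewrite (_ : (fun k => _) = cst xi); first exact: cvg_cst.
apply/funext => k.
by rewrite (mpow_invariant dm n_gt0 sK s'K s_bounded E0_graphs E0_gen pi_rep).
Qed.

(** A generator displaces the [k]-th iterate by at most twice its quotient norm, which tends to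
    0. *)
Lemma invariants_avg_lim xi : W (avg_lim xi).
Proof.
apply/(invariantsP dm sK s'K s_bounded E0_graphs E0_gen pi_rep) => i.
apply/eqP; rewrite -subr_eq0; apply/eqP.
have l1 : A i (avg_pow k xi) - avg_pow k xi @[k --> \oo] -->
    A i (avg_lim xi) - avg_lim xi.
  apply: cvgB; last exact: avg_lim_cvg.
  apply: continuous_cvg_seq; last exact: avg_lim_cvg.
  exact: rep_continuous pi_rep _ (CA i).
apply: (rcvg_uniq l1); apply/rcvgP.
apply: (@squeeze_cvgr _ _ _ _ (cst 0) (fun k => 2 * rnorm xi * rho ^+ k)).
- apply: nearW => k; rewrite rnorm_ge0 subr0/=.
  apply: le_trans (displacement_le dm pi_rep _ (CA i) _ _) _.
  + by move=> zeta; rewrite (rep_graph_isometry dm sK s'K s_bounded pi_rep).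
  + by move=> eta; exact: (invariants_step dm sK s'K s_bounded E0_graphs E0_gen pi_rep).
  by rewrite -mulrA ler_pM2l// mulrC.
- exact: cvg_cst.
rewrite -[X in _ --> X](mulr0 (2 * rnorm xi)); apply: cvgM; first exact: cvg_cst.
by apply: cvg_expr; have [r0 r1] := andP rho01; rewrite gtr0_norm.
Qed.

Lemma avg_lim_avg xi : avg_lim (pi (avg s) xi) = avg_lim xi.
Proof.
apply: (rcvg_uniq (@avg_lim_cvg _)).
rewrite (_ : (fun k => _) = fun k => avg_pow k.+1 xi).
  by have := @avg_lim_cvg xi; rewrite -cvg_shiftS.
by apply/funext => k; rewrite -(rep_mpowSr dm s_bounded pi_rep).
Qed.

(** Being unchanged by [avg], the limit is harmonic for the lazy walk with [n * 2] equally likely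
    steps; the vanishing of harmonic increments then compares applying generator [i] with staying
    put. *)
Lemma avg_lim_step i xi : avg_lim (A i xi) = avg_lim xi.
Proof.
pose Wk (j : 'I_n * bool) : {additive B -> B} :=
  if j.2 then rep_op pi_rep (CA j.1) else idfun.
pose Wk' (j : 'I_n * bool) : {additive B -> B} :=
  if j.2 then rep_op pi_rep (CA' j.1) else idfun.
(* Z has mean zero and \sum_j avg_lim (Wk j (Z j)) is avg_lim (A i xi) - avg_lim xi. *)
pose Z (j : 'I_n * bool) : B :=
  if j == (i, true) then xi else if j == (i, false) then - xi else 0.
have Zsum (F : 'I_n * bool -> B -> B) : (forall j, F j 0 = 0) ->
    \sum_j F j (Z j) = F (i, true) xi + F (i, false) (- xi).
  move=> F0; rewrite (bigD1 (i, true))//= (bigD1 (i, false)) /=; last first.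
    by rewrite xpair_eqE andbF.
  rewrite big1 ?addr0.
    by rewrite /Z eqxx /= xpair_eqE andbF eqxx.
  by move=> j /andP[j1 j2]; rewrite /Z (negbTE j1) (negbTE j2).
have := @harmonic_increment_eq0 R B K avg_lim_op K1 parallelogram
  avg_lim_contraction _ Wk Wk' Z.
rewrite (Zsum (fun j x => avg_lim_op (Wk j x))) => [|j]; last by rewrite !raddf0.
have limN x : avg_lim (- x) = - avg_lim x by exact: (raddfN avg_lim_op).
rewrite /Wk /= limN => h; apply/eqP; rewrite -subr_eq0; apply/eqP; apply: h.
- move=> [j []] x //=; exact: (rep_can dm sK s'K s_bounded pi_rep).
- by move=> [j []] x //=; rewrite (rep_graph_isometry dm sK s'K s_bounded pi_rep).
- move=> [j []] x //=; apply: (rep_contraction pi_rep).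
  exact: partial_translation_graph (inv_bounded dm s'K s_bounded j) (can_inj (s'K j)).
- move=> x; rewrite -(pair_bigA _ (fun a b => avg_lim_op (Wk (a, b) x)))/=.
  have -> : #|{: 'I_n * bool}| = (n * 2)%N by rewrite card_prod card_ord card_bool.
  rewrite -[avg_lim x]avg_lim_avg -[_ *+ _](raddfMn avg_lim_op).
  rewrite (avg_repE dm n_gt0 s_bounded pi_rep) raddf_sum; apply: eq_bigr => k _.
  by rewrite big_bool /= addrC; exact: (esym (raddfD avg_lim_op _ _)).
by rewrite (Zsum (fun j x => x))// subrr.
Qed.

Lemma avg_lim_inv_step i xi : avg_lim (A' i xi) = avg_lim xi.
Proof. by rewrite -(avg_lim_step i) (rep_can dm sK s'K s_bounded pi_rep). Qed.

Lemma avg_lim_continuous : continuous avg_lim.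
Proof.
apply: (@bounded_linear_continuous _ _ _ avg_lim_op); apply/linear_boundedP.
exists 1; split; first exact: real1.
move=> a /ltW a1 x; apply: (@le_trans _ _ `|x|); last by rewrite ler_peMl.
by rewrite -!rnormE lecR; exact: avg_lim_contraction.
Qed.

Lemma dual_invariants_avg f xi : dual_invariants d pi f -> f (pi (avg s) xi) = f xi.
Proof.
move=> fi; have [[f_lin _] _] := fi.
pose fl : {linear B -> C^o} := HB.pack f (GRing.isLinear.Build _ _ _ _ _ f_lin).
have f_sum (F : 'I_n -> B) : f (\sum_i F i) = \sum_i f (F i).
  exact: (raddf_sum fl).
have : f (pi (avg s) xi) *+ (n * 2) = f xi *+ (n * 2) :> C.
  rewrite -[LHS](raddfMn fl) /= (avg_repE dm n_gt0 s_bounded pi_rep) f_sum.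
  rewrite (eq_bigr (fun=> f xi *+ 2)) => [|i _].
    by rewrite sumr_const card_ord -mulrnA mulnC.
  by rewrite [LHS](raddfD fl) /= (dual_invariantsP dm sK s'K s_bounded pi_rep).
by apply: pmulrnI; rewrite muln_gt0 n_gt0.
Qed.

(** Invariant functionals agree on all iterates of [xi], hence kill [xi - avg_lim xi]. For
    uniqueness, a nonzero invariant vector must be detected by some invariant functional. *)
Lemma invprojE xi : invproj d pi xi = avg_lim xi.
Proof.
apply: xget_unique.
  split; first exact: invariants_avg_lim.
  move=> f fi; have [[f_lin f_cont] _] := fi.
  pose fl : {linear B -> C^o} := HB.pack f (GRing.isLinear.Build _ _ _ _ _ f_lin).
  have fpow k : f (avg_pow k xi) = f xi.
    elim: k => [|k IH]; first by rewrite (rep1 pi_rep).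
    by rewrite (rep_mpowS dm s_bounded pi_rep) dual_invariants_avg.
  rewrite [LHS](raddfB fl); apply/eqP; rewrite subr_eq0; apply/eqP.
  have : f (avg_pow k xi) @[k --> \oo] --> f (avg_lim xi).
    by apply: continuous_cvg; [exact: f_cont|exact: avg_lim_cvg].
  under eq_fun do rewrite fpow.
  by move=> h; apply: cvg_unique h; [exact: norm_hausdorff|exact: cvg_cst].
move=> eta [Weta coeta]; apply/eqP; rewrite -subr_eq0; apply/negPn/negP => z0.
set z := eta - avg_lim xi in z0.
have Wz : W z.
  rewrite /z addrC -scaleN1r; apply: (invariants_linear pi_rep dm) => //.
  exact: invariants_avg_lim.
have [g [g_lin g_cont] gz] := exists_dual_neq0 z0.
(* Composing a Hahn-Banach functional with the limit makes it invariant, by [avg_lim_inv_step],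
   without changing its value at the invariant vector [z]. *)
pose f x := g (avg_lim x).
have f_dual : dual_space f.
  split; first by move=> a x y; rewrite /f avg_lim_linear g_lin.
  by move=> x; apply: continuous_comp; [exact: avg_lim_continuous|exact: g_cont].
have fi : dual_invariants d pi f.
  apply: (dual_invariants_fixed dm sK s'K s_bounded E0_graphs E0_gen pi_rep f_dual).
  by move=> i x; rewrite /f avg_lim_inv_step.
pose gl : {linear B -> C^o} := HB.pack g (GRing.isLinear.Build _ _ _ _ _ g_lin).
have gl0 : g 0 = 0 by exact: (raddf0 gl).
move: gz; rewrite -(avg_lim_invariant Wz) -/(f z).
have -> : z = (xi - avg_lim xi) - (xi - eta).
  by rewrite /z opprB [RHS]addrC addrA subrK.
pose fl : {linear B -> C^o} := HB.pack f (GRing.isLinear.Build _ _ _ _ _ f_dual.1).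
rewrite [X in X != 0](raddfB fl) /= [X in _ - X](coeta _ fi) subr0.
have avgK : avg_lim (avg_lim xi) = avg_lim xi.
  exact: avg_lim_invariant (invariants_avg_lim xi).
by rewrite /f (_ : avg_lim _ = 0) ?gl0 ?eqxx// [LHS](raddfB avg_lim_op) /= avgK subrr.
Qed.

End AveragingLimit.

(** * The completion *)

Section Completion.
Context {R : realType} {I : Type} (BB : I -> completeNormedModType R[i]).
Context {X : choiceType} (d : X -> X -> \bar R).
Local Notation C := R[i].
Local Notation M := (X -> X -> C).
Local Notation N := (maxnorm BB d).
Implicit Types (a b : M) (u v : cauchy_type BB d) (p q : Cmax BB d).

Definition Cmax_class u : Cmax BB d := (\pi_(Cmax BB d) u)%qT.

Lemma Cmax_classB u v : Cmax_class (u - v) = Cmax_class u - Cmax_class v.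
Proof. exact: raddfB. Qed.

Lemma Cmax_class_rep p : Cmax_class (cauchy_rep p) = p.
Proof. exact: reprK. Qed.

Lemma Cmax_of_class a (Ca : Cu d a) :
  Cmax_of BB d a = Cmax_class (Cauchy (cauchy_cstP BB Ca)).
Proof.
rewrite /Cmax_of; case: pselect => // Ca'.
by rewrite (Prop_irrelevance Ca' Ca).
Qed.

Lemma cauchy_seqP u : forall k, Cu d (u k).
Proof. by have /asboolP[] := cauchy_valP u. Qed.

Lemma cauchy_rep_class u :
  N (cauchy_rep (Cmax_class u) k - u k) @[k --> \oo] --> (0 : R).
Proof.
have : cauchy_rep (Cmax_class u) - u \in @null_seq R I BB X d.
  by rewrite Quotient.idealrBE reprK.
by move/asboolP.
Qed.

Lemma maxnormN a : Cu d a -> N (- a) = N a.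
Proof.
have le b : Cu d b -> N (- b) <= N b.
  move=> Cb; rewrite -sub0r (le_trans (maxnormB BB (Cu0 d) Cb))//.
  by rewrite maxnorm0 add0r.
move=> Ca; apply/eqP; rewrite eq_le le//= -{1}(opprK a) le//.
by rewrite -sub0r; exact: CuB (Cu0 d) Ca.
Qed.

Lemma maxnorm_distD a b : Cu d a -> Cu d b -> `|N a - N b| <= N (a - b).
Proof.
move=> Ca Cb; have CN : Cu d (b - a) by exact: CuB.
have CN' : Cu d (a - b) by exact: CuB.
rewrite ler_norml; apply/andP; split.
  have := maxnormB BB Ca CN'; rewrite subKr => h; lra.
have := maxnormB BB Cb CN; rewrite subKr -(opprB a) maxnormN// => h; lra.
Qed.

(** Any Cauchy sequence in the class computes the norm: it differs by a null sequence from the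
    chosen representative. *)
Lemma cvg_Cmax_norm u : N (u k) @[k --> \oo] --> Cmax_norm (Cmax_class u).
Proof.
have rep_cvg : cvgn (fun k => N (cauchy_rep (Cmax_class u) k)).
  apply/cauchy_cvgP/cauchy_exP => e e0.
  have /asboolP[Cr cr] := cauchy_valP (cauchy_rep (Cmax_class u)).
  have [k0 hk] := cr _ e0.
  exists (N (cauchy_rep (Cmax_class u) k0)); exists k0 => // k /= k0k.
  rewrite -ball_normE /= (le_lt_trans (maxnorm_distD _ _))//.
  exact: hk.
set r := cauchy_rep (Cmax_class u) in rep_cvg *.
rewrite (_ : (fun k => N (u k)) = fun k => N (r k) - (N (r k) - N (u k))); last first.
  by apply/funext => k; rewrite opprB addrC subrK.
rewrite -[X in _ --> X]subr0; apply: cvgB; first exact: rep_cvg.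
apply/cvgr0Pnorm_le => e e0.
have /cvgr0Pnorm_le/(_ _ e0) := @cauchy_rep_class u; apply: filterS => k.
have C1 := cauchy_seqP (cauchy_rep (Cmax_class u)) k; have C2 := cauchy_seqP u k.
rewrite ger0_norm; last by apply: maxnorm_ge0; exact: CuB.
exact: le_trans (maxnorm_distD _ _).
Qed.

Lemma Cmax_norm_ge0 p : 0 <= Cmax_norm p.
Proof.
rewrite -(Cmax_class_rep p) -(cvg_lim (@Rhausdorff R) (@cvg_Cmax_norm (cauchy_rep p))).
apply: limr_ge; first exact: cvgP (@cvg_Cmax_norm _).
by apply: nearW => k; apply: maxnorm_ge0; exact: cauchy_seqP.
Qed.

Lemma Cmax_norm_le u (r : R) : (\forall k \near \oo, N (u k) <= r) ->
  Cmax_norm (Cmax_class u) <= r.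
Proof.
move=> ur; rewrite -(cvg_lim (@Rhausdorff R) (@cvg_Cmax_norm u)).
by apply: limr_le => //; exact: cvgP (@cvg_Cmax_norm u).
Qed.

Section Extension.
Context (i : I) (pi : M -> BB i -> BB i).
Hypothesis pi_rep : representation d pi.
Implicit Types xi : BB i.

Lemma rep_maxnorm a xi : Cu d a -> rnorm (pi a xi) <= N a * rnorm xi.
Proof.
move=> Ca; apply: le_trans (opnormP pi_rep _ Ca) _.
by rewrite ler_wpM2r ?rnorm_ge0// maxnorm_ub.
Qed.

Lemma cvg_Cmax_ext u xi : pi (u k) xi @[k --> \oo] --> Cmax_ext pi (Cmax_class u) xi.
Proof.
set r := cauchy_rep (Cmax_class u).
have rep_cvg : cvgn (fun k => pi (r k) xi).
  apply: rcauchy_cvg => e e0.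
  have x1 : 0 < 1 + rnorm xi by rewrite ltr_wpDr ?rnorm_ge0.
  have /asboolP[Cr cr] := cauchy_valP r.
  have [k0 hk] := cr _ (divr_gt0 e0 x1).
  exists k0 => k k0k; rewrite -(repB pi_rep)//.
  have CB := CuB (Cr k) (Cr k0).
  apply: le_lt_trans (rep_maxnorm _ CB) _.
  apply: (@le_lt_trans _ _ (N (r k - r k0) * (1 + rnorm xi))).
    by rewrite ler_wpM2l ?maxnorm_ge0// lerDr.
  by rewrite -ltr_pdivlMr// hk.
rewrite (_ : (fun k => _) = fun k =>
  pi (r k) xi - (pi (r k) xi - pi (u k) xi)); last first.
  by apply/funext => k; rewrite subKr.
rewrite -[X in _ --> X]subr0; apply: cvgB; first exact: rep_cvg.
apply/rcvgP.
apply: (@squeeze_cvgr _ _ _ _ (cst 0) (fun k => N (r k - u k) * rnorm xi)).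
- apply: nearW => k; rewrite subr0 rnorm_ge0 /=.
  rewrite -(repB pi_rep); [|exact: cauchy_seqP|exact: cauchy_seqP].
  by apply: rep_maxnorm; apply: CuB; exact: cauchy_seqP.
- exact: cvg_cst.
rewrite -[X in _ --> X](mul0r (rnorm xi)); apply: cvgM; last exact: cvg_cst.
exact: cauchy_rep_class.
Qed.

Lemma Cmax_extB p q xi :
  Cmax_ext pi (p - q) xi = Cmax_ext pi p xi - Cmax_ext pi q xi.
Proof.
rewrite -(Cmax_class_rep p) -(Cmax_class_rep q) -Cmax_classB.
set u := cauchy_rep p; set v := cauchy_rep q.
apply: (rcvg_uniq (@cvg_Cmax_ext _ _)).
rewrite (_ : (fun k => _) = fun k => pi (u k) xi - pi (v k) xi).
  by apply: cvgB; exact: cvg_Cmax_ext.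
apply/funext => k; rewrite -(repB pi_rep)//; exact: cauchy_seqP.
Qed.

Lemma Cmax_ext_norm p xi : rnorm (Cmax_ext pi p xi) <= Cmax_norm p * rnorm xi.
Proof.
rewrite -(Cmax_class_rep p); set u := cauchy_rep p.
have h1 := cvg_rnorm (@cvg_Cmax_ext u xi).
have h2 : N (u k) * rnorm xi @[k --> \oo] --> Cmax_norm (Cmax_class u) * rnorm xi.
  by apply: cvgM; [exact: cvg_Cmax_norm|exact: cvg_cst].
apply: (ler_cvg_to h1 h2); apply: nearW => k; apply: rep_maxnorm; exact: cauchy_seqP.
Qed.

End Extension.
End Completion.

(** * The equivalence *)

Section Equivalence.
Context {R : realType} {I : Type} (BB : I -> completeNormedModType R[i]).
Context {X : choiceType} (d : X -> X -> \bar R).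
Local Notation C := R[i].
Local Notation M := (X -> X -> C).
Hypothesis uc : uniformly_convex_family BB.
Hypothesis dm : extended_metric d.
Context {n : nat} (s s' : 'I_n -> X -> X).
Hypothesis n_gt0 : (0 < n)%N.
Hypothesis sK : forall i, cancel (s i) (s' i).
Hypothesis s'K : forall i, cancel (s' i) (s i).
Hypothesis s_bounded : forall i, bounded_displacement d (s i).
Variable E0 : set (X * X).
Hypothesis E0_graphs : forall x y, E0 (x, y) -> exists i, y = s i x.
Hypothesis E0_gen : generating d E0.
Hypothesis s_E0 : forall i, supp (graph_mx (s i) : M) `<=` E0.
Local Notation N := (maxnorm BB d).
Local Notation apow k := (mpow (avg s) k).

Let Cpow k : Cu d (apow k). Proof. exact: Cu_mpow_avg. Qed.

Let n0 : 0 < n%:R :> R. Proof. by rewrite ltr0n. Qed.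

(** The constants [e], [K] and [rho] are fixed before any representation is considered, so the
    geometric rate survives the supremum defining [maxnorm] and the powers form a Cauchy sequence
    there. *)
Lemma kazhdan_of_geometric_T : uniform_geometric_T BB d E0 ->
  exists p : Cmax BB d, kazhdan_projection (fun i => graph_mx (s i)) p.
Proof.
move=> [c c0 gap].
have [|e e01 ball_e] := @uniform_convexity_ball _ _ BB (c / (2 * n%:R)) uc.
  by rewrite divr_gt0// mulr_gt0.
have [K K1 parallelogram] := uniform_convexity_parallelogram uc.
pose rho : R := 1 - e / (2 * n%:R).
have [_ rho01] : 2^-1 <= rho /\ 0 < rho < 1 by exact: gap_rate_bounds.
have [rho0 rho1] := andP rho01.
have incr i (pi : M -> BB i -> BB i) (pi_rep : representation d pi) k xi :
    rnorm (pi (apow k.+1) xi - pi (apow k) xi) <= 2 * rnorm xi * rho ^+ k.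
  exact: (gap_increment dm n_gt0 sK s'K s_bounded E0_graphs E0_gen pi_rep c0
    (gap i pi pi_rep) e01 (@ball_e i)).
have ctr i (pi : M -> BB i -> BB i) (pi_rep : representation d pi) k xi :
    quot_norm (invariants d pi) (pi (apow k) xi) <= rho ^+ k * rnorm xi.
  exact: (gap_contraction_iter dm n_gt0 sK s'K s_bounded E0_graphs E0_gen pi_rep c0
    (gap i pi pi_rep) e01 (@ball_e i)).
(* The tail of the increments [2 * rho ^+ k] on unit vectors. *)
clearbody rho; pose b k := 2 * rho ^+ k / (1 - rho).
have b0 k : 0 <= b k.
  by rewrite divr_ge0 ?subr_ge0 ?(ltW rho1)// mulr_ge0// exprn_ge0// ltW.
have N_le k l : (k <= l)%N -> N (apow l - apow k) <= b k.
  move=> kl; apply: maxnorm_le => // i pi pi_rep.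
  have CB := CuB (Cpow l) (Cpow k).
  apply: ge_sup; first by have [] := opnorm_has_sup pi_rep CB.
  move=> _ [xi xi1 ->]; rewrite (repB pi_rep)//.
  apply: le_trans (geometric_increment rho01 (u := fun k => pi (apow k) xi)
    (fun k => incr i pi pi_rep k xi) kl) _.
  apply: ler_wpM2r; first by rewrite invr_ge0 subr_ge0 ltW.
  by apply: ler_wpM2r; [rewrite exprn_ge0// ltW|lra].
have N_le' k l : (k <= l)%N -> N (apow k - apow l) <= b k.
  by move=> kl; rewrite -opprB maxnormN ?N_le//; exact: CuB.
have u_cauchy : (fun k => apow k) \in @cauchy_seq R I BB X d.
  apply/asboolP; split=> // r r0.
  have [k0 hk0] := geometric_small rho01 2 r0; exists k0 => k l k0k k0l.
  have [kl|/ltnW lk] := leqP k l.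
    exact: le_lt_trans (N_le' _ _ kl) (hk0 _ k0k).
  exact: le_lt_trans (N_le _ _ lk) (hk0 _ k0l).
pose u := Cauchy u_cauchy; exists (Cmax_class u).
have rate_le k : Cmax_norm (Cmax_of BB d (apow k) - Cmax_class u) <= b k.
  rewrite (Cmax_of_class BB (Cpow k)) -Cmax_classB; apply: Cmax_norm_le.
  by exists k => // l /= kl; exact: N_le'.
split.
- move=> i pi pi_rep xi.
  rewrite (invprojE dm n_gt0 sK s'K s_bounded E0_graphs E0_gen pi_rep rho01
    (ctr i pi pi_rep) (incr i pi pi_rep) K1 (parallelogram i)).
  apply: (rcvg_uniq (@cvg_Cmax_ext _ _ _ _ _ _ _ pi_rep u xi)).
  exact: (avg_lim_cvg rho01 (incr i pi pi_rep)).
- apply: (@squeeze_cvgr _ _ _ _ (cst 0) b).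
  + by apply: nearW => k; rewrite Cmax_norm_ge0 /=; exact: rate_le.
  + exact: cvg_cst.
  apply/cvgrPdist_lt => r r0; have [k0 hk0] := geometric_small rho01 2 r0.
  exists k0 => // k /= k0k; rewrite sub0r normrN ger0_norm//; exact: hk0.
(* The series starts at the first power, which accounts for the additional factor [rho]. *)
apply: (@series_le_cvg _ _ (geometric (2 * rho / (1 - rho)) rho)).
- by move=> k; exact: Cmax_norm_ge0.
- move=> k; rewrite /geometric /= mulr_ge0 ?exprn_ge0 ?(ltW rho0)//.
  by rewrite divr_ge0 ?mulr_ge0 ?subr_ge0 ?(ltW rho0) ?(ltW rho1).
- move=> k; apply: le_trans (rate_le _) _; rewrite /b /geometric /= exprS.
  by rewrite le_eqVlt; apply/orP; left; apply/eqP; ring.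
by apply: is_cvg_geometric_series; rewrite gtr0_norm.
Qed.

(** * Quotient estimates for the converse direction *)

Section Converse.
Context (i : I) (pi : M -> BB i -> BB i).
Hypothesis pi_rep : representation d pi.
Implicit Types xi eta : BB i.
Local Notation W := (invariants d pi).

Let W0 : W 0. Proof. exact: invariants0. Qed.

Let W_lin (a : C) xi eta : W xi -> W eta -> W (a *: xi + eta).
Proof. exact: invariants_linear. Qed.

Let fixW k eta : W eta -> pi (apow k) eta = eta.
Proof. exact: (mpow_invariant dm n_gt0 sK s'K s_bounded E0_graphs E0_gen pi_rep). Qed.

Let quot_powE k xi eta : W eta ->
  quot_norm W (pi (apow k) xi) = quot_norm W (pi (apow k) (xi + eta)).
Proof. by move=> We; rewrite (rep_opD pi_rep)// (fixW k We) quot_normDr. Qed.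

(** True for the default value of [invproj] as well, since 0 is invariant. *)
Lemma invproj_invariant xi : W (invproj d pi xi).
Proof. by rewrite /invproj; case: xgetP => [y _ []|]. Qed.

Lemma quot_norm_pow_le k xi : quot_norm W (pi (apow k) xi) <= quot_norm W xi.
Proof.
apply: le_quot_norm => // eta We; rewrite (quot_powE k xi We).
apply: le_trans (quot_norm_le_norm W0 _) _.
elim: k => [|k IH]; first by rewrite (rep1 pi_rep).
rewrite (rep_mpowS dm s_bounded pi_rep) (le_trans _ IH)//.
exact: (avg_contraction dm n_gt0 sK s'K s_bounded pi_rep).
Qed.

(** Telescoping: each further step adds an iterate of [xi - pi (avg s) xi], and iterates do not
    increase the quotient norm. *)
Lemma quot_norm_sub_pow k xi :
  quot_norm W (xi - pi (apow k) xi) <= k%:R * quot_norm W (xi - pi (avg s) xi).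
Proof.
elim: k => [|k IH].
  by rewrite (rep1 pi_rep) subrr mul0r (le_trans (quot_norm_le_norm W0 _))// rnorm0.
have -> : xi - pi (apow k.+1) xi =
    (xi - pi (apow k) xi) + pi (apow k) (xi - pi (avg s) xi).
  by rewrite (rep_opB pi_rep)// (rep_mpowSr dm s_bounded pi_rep) addrA subrK.
apply: le_trans (quot_normD W0 W_lin _ _) _; rewrite -natr1 mulrDl mul1r.
by rewrite lerD// quot_norm_pow_le.
Qed.

(** The factor 1/2 reflects laziness: [1 - avg] is half the mean of the [1 - A j]. *)
Lemma quot_norm_sub_avg (r : R) xi :
  (forall j, quot_norm W (xi - pi (graph_mx (s j)) xi) <= r) ->
  quot_norm W (xi - pi (avg s) xi) <= r / 2.
Proof.
move=> hr; have n20 : 0 < (n * 2)%:R :> R by rewrite natrM mulr_gt0.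
rewrite -(ler_pM2l n20) -quot_norm_scale//.
rewrite rmorph_nat scaler_nat mulrnBl (avg_repE dm n_gt0 s_bounded pi_rep).
have -> : xi *+ (n * 2) - \sum_j (xi + pi (graph_mx (s j)) xi) =
    \sum_j (xi - pi (graph_mx (s j)) xi).
  rewrite big_split /= sumrB !sumr_const card_ord mulnC mulrnA mulr2n.
  by rewrite mulrnDl opprD addrA addrK.
have quot_sum (J : Type) (t : seq J) (F : J -> BB i) :
    quot_norm W (\sum_(j <- t) F j) <= \sum_(j <- t) quot_norm W (F j).
  elim: t => [|j t IH].
    by rewrite !big_nil (le_trans (quot_norm_le_norm W0 _))// rnorm0.
  by rewrite !big_cons (le_trans (quot_normD W0 W_lin _ _))// lerD2l.
apply: le_trans (quot_sum _ _ _) _.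
apply: (@le_trans _ _ (\sum_(j < n) r)); first by apply: ler_sum => j _.
by rewrite sumr_const_natl card_ord natrM; lra.
Qed.

End Converse.

Lemma geometric_T_of_kazhdan (p : Cmax BB d) :
  kazhdan_projection (fun i => graph_mx (s i)) p -> uniform_geometric_T BB d E0.
Proof.
move=> [p_inv /cvgr0Pnorm_lt/(_ (2^-1)) [|k0 _ k0P _]]; first by rewrite invr_gt0.
(* The successor guarantees [m > 0], so that division by [m] is legitimate. *)
pose m := k0.+1; have {k0P} rate_m : Cmax_norm (Cmax_of BB d (apow m) - p) <= 2^-1.
  by apply/ltW/(le_lt_trans (ler_norm _)); exact: k0P (leqnSn _).
have m0 : 0 < m%:R :> R by rewrite ltr0n.
(* The gap proved is [1 / (2 m)]; the uniform constant has to be strictly smaller. *)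
exists (4 * m%:R)^-1 => [|i pi pi_rep]; first by rewrite invr_gt0 mulr_gt0.
exists (2 * m%:R)^-1 => [|xi xi1].
  by rewrite ltf_pV2 ?posrE ?mulr_gt0// ltr_pM2r// ltr_nat.
set W := invariants d pi in xi1 *.
have W0 : W 0 by exact: invariants0.
have W_lin (a : C) x y : W x -> W y -> W (a *: x + y) by exact: invariants_linear.
have pow_half : quot_norm W (pi (apow m) xi) <= 2^-1 * quot_norm W xi.
  rewrite -ler_pdivrMl ?invr_gt0//.
  apply: le_quot_norm => // eta We; rewrite ler_pdivrMl ?invr_gt0//.
  have -> : quot_norm W (pi (apow m) xi) = quot_norm W (pi (apow m) (xi + eta)).
    rewrite (rep_opD pi_rep)// (mpow_invariant dm n_gt0 sK s'K s_bounded E0_graphs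
      E0_gen pi_rep m We).
    by rewrite quot_normDr.
  set z := xi + eta.
  (* Subtracting an invariant vector leaves the class unchanged, and [p] acts as [invproj], so the
     distance from [apow m] to [p] bounds the quotient norm. *)
  have Winv : W (- invproj d pi z).
    by rewrite -[- _]addr0 -scaleN1r; apply: W_lin => //; exact: invproj_invariant.
  apply: le_trans (quot_norm_le _ Winv) _.
  rewrite -(p_inv i pi pi_rep) -(Cmax_ext_of z pi_rep (Cpow m)) -(Cmax_extB pi_rep).
  apply: le_trans (Cmax_ext_norm pi_rep _ _) _.
  by apply: ler_wpM2r; [exact: rnorm_ge0|exact: rate_m].
have half : 2^-1 <= quot_norm W (xi - pi (apow m) xi).
  have := quot_normD W0 W_lin (xi - pi (apow m) xi) (pi (apow m) xi).
  by move: pow_half; rewrite subrK xi1; lra.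
have [[j hj]|small] := pselect (exists j, (2 * m%:R)^-1 <=
    quot_norm W (xi - pi (graph_mx (s j)) xi)).
  exists (graph_mx (s j)); split=> //.
    exact: partial_translation_graph (s_bounded j) (can_inj (sK j)).
  by rewrite chiR_graph (rep1 pi_rep) -opprB quot_normN.
(* If all generators moved the class by less than [1 / (2 m)], then [m] steps would move it by at
   most 1/4, against the lower bound 1/2. *)
exfalso; have : quot_norm W (xi - pi (avg s) xi) <= (2 * m%:R)^-1 / 2.
  apply: quot_norm_sub_avg => // j; apply/ltW; rewrite ltNge; apply/negP => hj.
  by apply: small; exists j.
rewrite -(ler_pM2l m0) => h.
have := quot_norm_sub_pow pi_rep m xi; rewrite -/W => h2.
have h3 : m%:R * ((2 * m%:R)^-1 / 2) = 4^-1 :> R by field; rewrite gt_eqF.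
by rewrite h3 in h; lra.
Qed.

End Equivalence.

Theorem theorem4p5 (R : realType) (I : Type)
    (BB : I -> completeNormedModType R[i])
    (Xn : nat -> finType) (dn : forall k : nat, Xn k -> Xn k -> R)
    (E0 : set ({k : nat & Xn k} * {k : nat & Xn k}))
    (n : nat) (A : 'I_n -> {k : nat & Xn k} -> {k : nat & Xn k} -> R[i]) :
  uniformly_convex_family BB ->
  (forall k : nat, is_metric (dn k)) ->
  bounded_geometry (sepdist dn) ->
  monogenic (sepdist dn) ->
  generating (sepdist dn) E0 ->
  symmetric_entourage E0 ->
  generating_translations (sepdist dn) E0 A ->
  (uniform_geometric_T BB (sepdist dn) E0 <->
  exists p : Cmax BB (sepdist dn), kazhdan_projection A p).
Proof.
move=> uc dnm _ _ E0_gen _ [n_gt0 A_full A_gen].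
have dm := sepdist_extended_metric dnm.
pose X : Type := {k & Xn k}.
have /choice[ss ssP] : forall i, exists t : (X -> X) * (X -> X),
    [/\ cancel t.1 t.2, cancel t.2 t.1 & A i = graph_mx t.1].
  move=> i; have [[_ [f [g fK gK] Af]] _] := A_full i.
  exists (f, g); split=> //.
  by apply/funext => x; apply/funext => y; rewrite Af.
pose s i := (ss i).1; pose s' i := (ss i).2.
have sK i : cancel (s i) (s' i) by case: (ssP i).
have s'K i : cancel (s' i) (s i) by case: (ssP i).
have AE : A = fun i => graph_mx (s i).
  by apply/funext => i; case: (ssP i).
rewrite {}AE {ssP} in A_full A_gen *.
have s_bounded i : bounded_displacement (sepdist dn) (s i).
  have [[[[_ [r sr]] _ _ _] _] _] := A_full i.
  by exists r => x; apply: (sr (x, s i x)); rewrite /supp /graph_mx /= eqxx oner_neq0.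
have s_E0 i : supp (graph_mx (s i) : _ -> _ -> R[i]) `<=` E0 by case: (A_full i).
have E0_graphs x y : E0 (x, y) -> exists i, y = s i x.
  move=> E0xy.
  (* The matrix unit at a pair of [E0] is a partial translation supported in [E0]; its decomposition
     into the [A i] can have a nonzero entry there only if some generator maps [x] to [y]. *)
  pose V : {k & Xn k} -> {k & Xn k} -> R[i] := fun a b => ((a == x) && (b == y))%:R.
  have V0 a b : V a b != 0 -> a = x /\ b = y.
    by rewrite /V; case: andP => [[/eqP -> /eqP ->]|]; rewrite ?eqxx.
  have VE0 : supp V `<=` E0 by move=> [a b] /V0 /= [-> ->].
  have Vp : partial_translation (sepdist dn) V.
    split.
    - split; last by have [r E0r] := E0_gen.1; exists r => ab /VE0/E0r.
      by exists 1 => a b; rewrite /V; case: (_ && _); rewrite ?rnorm_C1 ?rnorm0.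
    - by move=> a b; rewrite /V; case: (_ && _); [right|left].
    - by move=> a b c /V0[_ ->] /V0[_ ->].
    - by move=> a b c /V0[-> _] /V0[-> _].
  have [Bs _ /(congr1 (fun T => T x y))] := A_gen V Vp VE0.
  rewrite matrix_sumE /V !eqxx /= => V1.
  apply/not_existsP => nos; have := oner_neq0 R[i].
  rewrite -[1]/(true%:R) V1 big1 ?eqxx// => i _.
  by rewrite mmul_diag /graph_mx; case: eqP => [/nos//|]; rewrite mulr0.
split; first exact: kazhdan_of_geometric_T.
by move=> [p]; exact: geometric_T_of_kazhdan.
Qed.
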